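(* Let $d\ge 1$ and let $P\subset\mathbf{\bar H}^{(d)}\subset\mathbb{R}^d$ be a $(d-1)$-dimensional Nakajima polytope (with respect to the lattice $\mathbb{Z}^d$). Let $\tau_P=\{\kappa\,\mathbf{x}:\kappa\in\mathbb{R}_{\ge 0},\ \mathbf{x}\in P\}\subset\mathbb{R}^d$. Then the monoid algebra $R_P=\mathbb{C}[\tau_P\cap\mathbb{Z}^d]$ (the coordinate ring of the affine toric variety $U_{\tau_P^\vee}$ associated to the dual cone of $\tau_P$) is a Koszul algebra.
   Context: $\mathbf{\bar H}^{(d)}=\{\mathbf{x}=(x_1,\dots,x_d)^\intercal\in\mathbb{R}^d: x_1=1\}$. Points of $\mathbb{R}^d$ are columns, points of the dual space are rows, and $\langle m,\mathbf{x}\rangle=\sum_j m_jx_j$. Grading: $R_P$ is graded by giving the monomial of a lattice point $\mathbf{x}\in\tau_P\cap\mathbb{Z}^d$ the degree $x_1$. A graded $\mathbb{C}$-algebra $R$ with maximal homogeneous ideal $\mathfrak{m}$ is Koszul if the $R$-module $\mathbb{C}=R/\mathfrak{m}$ has a linear free resolution, i.e. there is an exact sequence $\cdots\to\mathfrak{R}_{2}\to\mathfrak{R}_1\to\mathfrak{R}_0\to R/\mathfrak{m}\to 0$ of graded free $R$-modules such that the matrices of all maps $\mathfrak{R}_{i+1}\to\mathfrak{R}_i$ have entries that are linear forms (forms of degree 1). Lattice equivalence: for free $\mathbb{Z}$-modules $N_1,N_2$ and lattice polytopes $P_j\subset(N_j)_{\mathbb{R}}$, $P_1\sim P_2$ means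 that there is an affine map $\varpi:(N_1)_{\mathbb{R}}\to(N_2)_{\mathbb{R}}$ restricting to a bijection $\operatorname{aff}(P_1)\to\operatorname{aff}(P_2)$, mapping $P_1$ onto $P_2$ and mapping $\operatorname{aff}(P_1)\cap N_1$ bijectively onto $\operatorname{aff}(P_2)\cap N_2$. Nakajima polytopes: a sequence of free parameters of length $\ell$ ($1\le\ell\le d-1$) is a sequence $\mathbf{m}=(m_1,\dots,m_\ell)$ of nonzero integer row vectors $m_i=(m_{i,1},\dots,m_{i,d})$ with $m_{i,j}=0$ whenever $i<j$. Put $P_{\mathbf{m}}^{(1)}=\{(1,0,\dots,0)^\intercal\}$ and, for $2\le i\le d$ (with $\mathbf{m}$ of length $i-1$), inductively $$P_{\mathbf{m}}^{(i)}=\operatorname{conv}\Big(P_{\mathbf{m}}^{(i-1)}\cup\{(x_1,\dots,x_{i-1},\langle m_{i-1},\mathbf{x}\rangle,0,\dots,0)^\intercal:\ \mathbf{x}=(x_1,\dots,x_{i-1},0,\dots,0)^\intercal\in P_{\mathbf{m}}^{(i-1)}\}\Big),$$ where $\mathbf{m}$ is required to be admissible: at each step $\langle m_{i-1},\mathbf{x}\rangle\ge 0$ for all $\mathbf{x}\in P_{\mathbf{m}}^{(i-1)}$. A lattice $(i-1)$-polytope is a Nakajima polytope (w.r.t. $\mathbb{R}^d$) if it is lattice equivalent to some such $P_{\mathbf{m}}^{(i)}$. *)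

(* Defs.v *)
From HB Require Import structures.
From mathcomp Require Import all_boot all_order all_algebra.
From mathcomp Require Import generic_quotient ring_quotient complex.
From mathcomp Require Import boolp classical_sets functions reals.
From mathcomp Require Import finmap monalg.

Set Implicit Arguments.
Unset Strict Implicit.
Unset Printing Implicit Defensive.

Import Order.TTheory GRing.Theory Num.Theory.

Local Open Scope classical_set_scope.
Local Open Scope ring_scope.
Local Open Scope quotient_scope.

Section Polytopes.
Variable R : realType.

Definition conv n (S : set 'cV[R]_n) : set 'cV[R]_n :=
  [set x | exists N (c : 'I_N -> R) (p : 'I_N -> 'cV[R]_n),
     [/\ forall i, 0 <= c i, \sum_i c i = 1, forall i, S (p i)
       & x = \sum_i c i *: p i]].

Definition aff n (S : set 'cV[R]_n) : set 'cV[R]_n :=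
  [set x | exists N (c : 'I_N -> R) (p : 'I_N -> 'cV[R]_n),
     [/\ \sum_i c i = 1, forall i, S (p i) & x = \sum_i c i *: p i]].

(* [aff_dim S k] says that aff S is a translate x0 + <rows of B> of a linear
   subspace of dimension k. *)
Definition aff_dim n (S : set 'cV[R]_n) (k : nat) : Prop :=
  exists (x0 : 'cV[R]_n) (B : 'M[R]_(k, n)),
    row_free B /\ aff S = [set x | ((x - x0)^T <= B)%MS].

Definition intvec n (z : 'cV[int]_n) : 'cV[R]_n := map_mx intr z.

Definition lattice n : set 'cV[R]_n := range (@intvec n).

Definition lattice_polytope n (P : set 'cV[R]_n) : Prop :=
  exists s : seq 'cV[int]_n,
    s <> [::] /\ P = conv [set intvec z | z in [set` s]].

Definition lattice_equiv n1 n2 (P1 : set 'cV[R]_n1) (P2 : set 'cV[R]_n2)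
    : Prop :=
  exists (A : 'M[R]_(n2, n1)) (b : 'cV[R]_n2),
    let phi x := A *m x + b in
    [/\ set_bij (aff P1) (aff P2) phi, phi @` P1 = P2
      & set_bij (aff P1 `&` @lattice n1) (aff P2 `&` @lattice n2) phi].

(* From here on the ambient space is R^d with d = n.+1, and coordinates are
   numbered from 0: x_1 is [x ord0 0]. *)

Definition Hbar n : set 'cV[R]_n.+1 := [set x | x ord0 0 = 1].

Definition pairing n (m : 'rV[int]_n) (x : 'cV[R]_n) : R :=
  \sum_j (m 0 j)%:~R * x j 0.

(* The k-th entry of m (from 0) is the row vector m_{k+1}, which may only
   involve x_1, ..., x_{k+1}. *)
Definition free_parameters n (m : seq 'rV[int]_n.+1) : Prop :=
  forall k, (k < size m)%N ->
    m`_k != 0 /\ forall j : 'I_n.+1, (k < j)%N -> m`_k 0 j = 0.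

(* (x_1, ..., x_k, <r, x>, 0, ..., 0)^T *)
Definition raise n (k : nat) (r : 'rV[int]_n.+1) (x : 'cV[R]_n.+1)
    : 'cV[R]_n.+1 :=
  \col_j (if (j < k)%N then x j 0 else
          if j == k :> nat then pairing r x else 0).

(* [nakajima_polytope m k] is P_m^(k+1). *)
Fixpoint nakajima_polytope n (m : seq 'rV[int]_n.+1) (k : nat)
    : set 'cV[R]_n.+1 :=
  if k is k'.+1 then
    conv (nakajima_polytope m k' `|`
          raise k (m`_k') @` nakajima_polytope m k')
  else [set delta_mx ord0 0].

Definition admissible n (m : seq 'rV[int]_n.+1) : Prop :=
  forall k, (k < size m)%N ->
    forall x, nakajima_polytope m k x -> 0 <= pairing m`_k x.

Definition is_nakajima n (P : set 'cV[R]_n.+1) : Prop :=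
  exists m : seq 'rV[int]_n.+1,
    [/\ (size m <= n)%N, free_parameters m, admissible m
      & lattice_equiv P (nakajima_polytope m (size m))].

Definition tau n (P : set 'cV[R]_n) : set 'cV[R]_n :=
  [set y | exists kappa : R, exists x, [/\ 0 <= kappa, P x & y = kappa *: x]].

End Polytopes.

Arguments intvec R {n} z.
Arguments lattice R n : clear implicits.
Arguments Hbar R n : clear implicits.

Section ConeMonoid.
Variables (R : realType) (n : nat) (P : set 'cV[R]_n.+1).
Hypotheses (hP : lattice_polytope P) (hH : P `<=` Hbar R n).

Lemma conv_convex k (S : set 'cV[R]_k) (t : R) x y :
  0 <= t -> t <= 1 -> conv S x -> conv S y ->
  conv S (t *: x + (1 - t) *: y).
Proof.
move=> t0 t1 [N1 [c1 [p1 [c1_ge0 c1_sum Sp1 ->]]]].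
move=> [N2 [c2 [p2 [c2_ge0 c2_sum Sp2 ->]]]].
pose c i := match @fintype.split N1 N2 i with
  inl j => t * c1 j | inr j => (1 - t) * c2 j end.
pose p i := match @fintype.split N1 N2 i with inl j => p1 j | inr j => p2 j end.
have cl j : c (lshift N2 j) = t * c1 j.
  by rewrite /c -[lshift _ _]/(unsplit (inl j)) unsplitK.
have cr j : c (rshift N1 j) = (1 - t) * c2 j.
  by rewrite /c -[rshift _ _]/(unsplit (inr j)) unsplitK.
have pl j : p (lshift N2 j) = p1 j.
  by rewrite /p -[lshift _ _]/(unsplit (inl j)) unsplitK.
have pr j : p (rshift N1 j) = p2 j.
  by rewrite /p -[rshift _ _]/(unsplit (inr j)) unsplitK.
exists (N1 + N2)%N, c, p; split.
- by move=> i; rewrite /c; case: fintype.split => j; rewrite mulr_ge0 // subr_ge0.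
- rewrite big_split_ord /=; under eq_bigr do rewrite cl.
  under [X in _ + X]eq_bigr do rewrite cr.
  by rewrite -!mulr_sumr c1_sum c2_sum !mulr1 addrC subrK.
- by move=> i; rewrite /p; case: fintype.split.
rewrite big_split_ord /= !scaler_sumr; congr (_ + _).
  by apply: eq_bigr => j _; rewrite cl pl scalerA.
by apply: eq_bigr => j _; rewrite cr pr scalerA.
Qed.

Lemma tau0 : tau P 0.
Proof.
have [[|z s] [// _ PE]] := hP.
exists 0, (intvec R z); split; rewrite ?scale0r //.
rewrite PE; exists 1%N, (fun=> 1), (fun=> intvec R z); split => //.
- by rewrite big_ord1.
- by move=> _; exists z => //=; rewrite mem_head.
by rewrite big_ord1 scale1r.
Qed.

Lemma tauD x y : tau P x -> tau P y -> tau P (x + y).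
Proof.
have [s [_ PE]] := hP.
move=> [a [u [a0 Pu ->]]] [b [v [b0 Pv ->]]].
have [ab0|ab_neq0] := eqVneq (a + b) 0.
  have /andP[/eqP-> /eqP->] : (a == 0) && (b == 0) by rewrite -paddr_eq0 // ab0.
  by rewrite !scale0r addr0; apply: tau0.
have ab_gt0 : 0 < a + b by rewrite lt_def ab_neq0 addr_ge0.
exists (a + b), (a / (a + b) *: u + (1 - a / (a + b)) *: v); split.
- exact: ltW.
- rewrite PE; apply: conv_convex; rewrite -?PE //.
    by rewrite divr_ge0 // ltW.
  by rewrite ler_pdivrMr // mul1r lerDl.
rewrite scalerDr !scalerA mulrBr mulr1 mulrCA divff // mulr1.
by rewrite addrAC subrr add0r.
Qed.

Lemma tau_unit x y : tau P x -> tau P y -> x + y = 0 -> x = 0.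
Proof.
move=> [a [u [a0 Pu ->]]] [b [v [b0 Pv ->]]].
move/(congr1 (fun w : 'cV[R]_n.+1 => w ord0 0)).
rewrite !mxE (hH Pu) (hH Pv) !mulr1 => /eqP.
by rewrite paddr_eq0 // => /andP[/eqP-> _]; rewrite scale0r.
Qed.

Lemma intvecD k (x y : 'cV[int]_k) : intvec R (x + y) = intvec R x + intvec R y.
Proof. by apply/matrixP => i j; rewrite !mxE intrD. Qed.

Lemma intvec0 k : intvec R (0 : 'cV[int]_k) = 0.
Proof. by apply/matrixP => i j; rewrite !mxE. Qed.

Lemma intvec_inj k : injective (@intvec R k).
Proof.
move=> x y /matrixP xy; apply/matrixP => i j.
by have := xy i j; rewrite !mxE => /eqP; rewrite eqr_int => /eqP.
Qed.

Definition in_tau : pred 'cV[int]_n.+1 := fun z => `[< tau P (intvec R z) >].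

(* The monoid of lattice points of the cone tau_P, in the multiplicative
   signature used by monalg; hP and hH are what makes it a monoid without
   nontrivial units. *)
Definition cone_monoid of lattice_polytope P & P `<=` Hbar R n :=
  {z : 'cV[int]_n.+1 | in_tau z}.

Local Notation M := (cone_monoid hP hH).

HB.instance Definition _ := Choice.on M.

Fact in_tau0 : in_tau 0.
Proof. by apply/asboolP; rewrite intvec0; apply: tau0. Qed.

Fact in_tauD (x y : M) : in_tau (val x + val y).
Proof.
apply/asboolP; rewrite intvecD.
by apply: tauD; apply/asboolP; [exact: (valP x) | exact: (valP y)].
Qed.

Definition cone_one : M := exist _ 0 in_tau0.
Definition cone_mul (x y : M) : M := exist _ (val x + val y) (in_tauD x y).

Fact cone_mulA : associative cone_mul.
Proof. by move=> x y z; apply: val_inj; rewrite /= addrA. Qed.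

Fact cone_mul1m : left_id cone_one cone_mul.
Proof. by move=> x; apply: val_inj; rewrite /= add0r. Qed.

Fact cone_mulm1 : right_id cone_one cone_mul.
Proof. by move=> x; apply: val_inj; rewrite /= addr0. Qed.

Fact cone_mulC : commutative cone_mul.
Proof. by move=> x y; apply: val_inj; rewrite /= addrC. Qed.

Fact cone_unitm (x y : M) :
  cone_mul x y = cone_one -> x = cone_one /\ y = cone_one.
Proof.
have main (u v : M) : cone_mul u v = cone_one -> u = cone_one.
  move=> /(congr1 val) /= uv0; apply: val_inj; apply: (@intvec_inj n.+1) => /=.
  rewrite intvec0; apply: (@tau_unit _ (intvec R (val v))).
  - exact/asboolP/(valP u).
  - exact/asboolP/(valP v).
  by rewrite -intvecD uv0 intvec0.
by move=> xy; split; [exact: (main x y) | apply: (main y x); rewrite cone_mulC].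
Qed.

HB.instance Definition _ := Choice_isMonomialDef.Build M
  cone_mulA cone_mul1m cone_mulm1 cone_unitm.
HB.instance Definition _ := MonomialDef_isConomialDef.Build M cone_mulC.

(* The homogeneous part of degree k is spanned by the monomials of the lattice
   points x with x_1 = k. *)
Definition cone_grading (k : nat) : set {malg R[i][M]} :=
  [set a | forall x : M, x \in msupp a -> (val x) ord0 0 = k%:Z].

End ConeMonoid.

Arguments cone_grading {R n P} hP hH k _.

Section Koszul.
Variables (F : fieldType) (A : comAlgType F) (gr : nat -> set A).

(* A = \bigoplus_k gr k is a graded F-algebra with gr 0 = F. *)
Definition graded_algebra : Prop :=
  [/\ forall k, gr k 0 /\ forall (c : F) u v, gr k u -> gr k v ->
        gr k (c *: u + v),
      forall a, exists N (c : nat -> A),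
        (forall k, gr k (c k)) /\ a = \sum_(k < N) c k,
      forall N (c : nat -> A), (forall k, gr k (c k)) ->
        \sum_(k < N) c k = 0 -> forall k, (k < N)%N -> c k = 0,
      forall i j u v, gr i u -> gr j v -> gr (i + j)%N (u * v)
    & gr 0%N = range (fun c : F => c%:A)].

Definition homogeneous_ideal (I : {pred A}) : Prop :=
  forall N (c : nat -> A), (forall k, gr k (c k)) ->
    \sum_(k < N) c k \in I -> forall k, (k < N)%N -> c k \in I.

(* [idealr A] is the type of proper ideals of A. *)
Definition maximal_homogeneous_ideal (I : idealr A) : Prop :=
  homogeneous_ideal I /\
  forall J : idealr A, homogeneous_ideal J ->
    {subset I <= J} -> {subset J <= I}.

Definition gr_int (z : int) : set A :=
  if z is Posz k then gr k else [set 0].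

(* The k-th module is free with basis e_0, ..., e_(b k - 1), where e_j has
   degree s k j.  Its elements are rows of coordinates; D k is the matrix of the
   map from the (k+1)-st to the k-th module, acting on the right, and eps j is
   the image of the basis vector e_j of the 0-th module in A / I. *)
Definition has_linear_resolution (I : idealr A) : Prop :=
  exists (b : nat -> nat) (s : forall k, 'I_(b k) -> int)
    (eps : 'I_(b 0%N) -> {ideal_quot I}) (D : forall k, 'M[A]_(b k.+1, b k)),
  let aug (v : 'rV[A]_(b 0%N)) : {ideal_quot I} :=
    \sum_j \pi_{ideal_quot I} (v 0 j) * eps j in
  [/\ (forall j, exists2 a, gr_int (s 0%N j) a & eps j = \pi_{ideal_quot I} a)
        /\ (forall k i j, gr_int (s k.+1 i - s k j) (D k i j)),
      forall k i j, gr 1%N (D k i j),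
      forall q, exists v, aug v = q,
      forall v, aug v = 0 <-> exists w, v = w *m D 0%N
    & forall k (v : 'rV[A]_(b k.+1)), v *m D k = 0 <->
        exists w, v = w *m D k.+1].

Definition koszul : Prop :=
  graded_algebra /\
  exists I : idealr A, maximal_homogeneous_ideal I /\ has_linear_resolution I.

End Koszul.

(* Main.v *)
From HB Require Import structures.
Require Import Defs.
From mathcomp Require Import all_boot all_order all_algebra.
From mathcomp Require Import generic_quotient ring_quotient.
From mathcomp Require Import complex boolp classical_sets functions reals.
From mathcomp Require Import finmap monalg.
From mathcomp Require Import zify ring.

(** Up to lattice equivalence, the graded monoid of lattice points of the cone
    over a Nakajima polytope arises from the monoid of natural numbers by
    repeatedly replacing a monoid N by the wedge
      N' = { (y, t) : y in N, 0 <= t <= f(y) },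
    where f is an additive function that is nonnegative on N
    ([nakajima_polytopeE], [nakajima_lattice_points]).  So a property of graded
    monoids is needed that passes to wedges and implies Koszulness.

    The property is a Koszul filtration by monomial ideals: a family F of
    ideals such that every member has a list of generators of degree 1 whose
    successive colon ideals (u_1, ..., u_(i-1)) : u_i belong to F.  If the
    maximal homogeneous ideal is in F, the algebra is Koszul
    ([linear_resolution]).  The reason is that the property is inherited by
    syzygies.  Suppose that the rows g_1, ..., g_r have linear entries and
    colon ideals in F.  For every generator y of the colon ideal of g_i there
    is a syzygy y e_i - sum_(j < i) a_j e_j, with the a_j linear for reasons of
    degree.  These syzygies generate all of them, and their colon ideals are
    those of the generators y, hence again in F.  Iterating this produces the
    matrices of the resolution.

    To pass to a wedge the induction has to carry one more invariant: for every
    additive g that is nonnegative on N, the prime ideal { g > 0 } belongs to F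
    ([face_filtration]).  The family for N' consists of the ideals
      I' = { (y, t) : y in I },  I' + { t < f(y) },  I' + { t > 0 },  I in F.
    To generate I', put the whole fibre (u, 0), ..., (u, f(u)) over every
    generator u of I; the colon ideal at (u, j) is (J : u)' for j = 0 and
    (J : u)' + { t < f(y) } for j > 0, J being the ideal of the generators
    before u.  The ideal { t < f(y) } of the points off the top facet is
    generated in the same way by the fibres without their top points over the
    generators of { f > 0 }, and this is where the invariant is used.  The
    ideal { t > 0 } is its mirror image under t |-> f(y) - t.  The invariant
    persists because g(y, t) = g(y, 0) + c t, and { g > 0 } has one of the three
    forms above according to the sign of c ([wedge_filtration]).  The maximal
    homogeneous ideal is the instance g = degree of the invariant. *)

Set Implicit Arguments.
Unset Strict Implicit.
Unset Printing Implicit Defensive.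

Import Order.TTheory GRing.Theory Num.Theory.

Local Open Scope classical_set_scope.
Local Open Scope ring_scope.
Local Open Scope quotient_scope.

(** * Step conditions along a list *)

Definition stepwise T (ok : seq T -> T -> Prop) (s : seq T) : Prop :=
  forall s1 x s2, s = s1 ++ x :: s2 -> ok s1 x.

Lemma stepwise_nil T (ok : seq T -> T -> Prop) : stepwise ok [::].
Proof. by move=> [|? ?] ? ?. Qed.

Lemma stepwise_rcons T (ok : seq T -> T -> Prop) s x :
  stepwise ok s -> ok s x -> stepwise ok (rcons s x).
Proof.
move=> oks okx s1 y s2; case/lastP: s2 => [|s2 z].
  by rewrite cats1 => /rcons_inj[<- <-].
by rewrite -rcons_cons -rcons_cat => /rcons_inj[/oks].
Qed.

Lemma stepwise_ind (T : eqType) (ok : seq T -> T -> Prop) (P : seq T -> Prop) s :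
    stepwise ok s -> P [::] ->
    (forall s1 u, u \in s -> ok s1 u -> P s1 -> P (rcons s1 u)) -> P s.
Proof.
move=> oks P0 PS; suff main s1 s2 : s = s1 ++ s2 -> P s1.
  by apply: main (esym (cats0 s)).
elim/last_ind: s1 s2 => [|s1 u IHs] s2 sE //.
rewrite cat_rcons in sE; apply: PS; last exact: IHs sE.
  by rewrite sE mem_cat mem_head orbT.
exact: oks sE.
Qed.

Lemma map_split (S T : Type) (f : S -> T) s t1 y t2 : map f s = t1 ++ y :: t2 ->
  exists s1 x s2, [/\ s = s1 ++ x :: s2, map f s1 = t1 & f x = y].
Proof.
elim: t1 s => [|z t1 IHt] [|x s] //= [xE sE]; first by exists [::], x, s.
have [s1 [u [s2 [-> s1E uE]]]] := IHt _ sE.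
by exists (x :: s1), u, s2; rewrite /= xE s1E.
Qed.

(** * Linear resolutions from Koszul filtrations *)

Section Span.
Variables (A : comNzRingType) (V : lmodType A).
Implicit Types (l : seq V) (v g : V).

Definition in_span l v : Prop :=
  exists c : nat -> A, v = \sum_(j < size l) c j *: l`_j.

Lemma in_span_nil v : in_span [::] v <-> v = 0.
Proof.
split=> [[c ->]|->]; first by rewrite big_ord0.
by exists (fun=> 0); rewrite big_ord0.
Qed.

Lemma in_span_rcons l g v :
  in_span (rcons l g) v <-> exists a, in_span l (v - a *: g).
Proof.
have sumE (c : nat -> A) : \sum_(j < size (rcons l g)) c j *: (rcons l g)`_j =
    \sum_(j < size l) c j *: l`_j + c (size l) *: g.
  rewrite size_rcons big_ord_recr /= nth_rcons ltnn eqxx; congr (_ + _).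
  by apply: eq_bigr => j _; rewrite nth_rcons ltn_ord.
split=> [[c ->]|[a [c vE]]].
  by exists (c (size l)), c; rewrite sumE addrK.
exists (fun j => if (j < size l)%N then c j else a).
rewrite (sumE (fun j => if (j < size l)%N then c j else a)) ltnn.
under eq_bigr do rewrite ltn_ord.
by rewrite -vE subrK.
Qed.

Lemma in_span_mem l v : v \in l -> in_span l v.
Proof.
move=> vl; exists (fun j => (j == index v l)%:R).
have lt_vl : (index v l < size l)%N by rewrite index_mem.
rewrite (bigD1 (Ordinal lt_vl)) //= eqxx scale1r nth_index // big1 ?addr0 // => j.
by rewrite -val_eqE /= => /negPf->; rewrite scale0r.
Qed.

Lemma in_span0 l : in_span l 0.
Proof. by exists (fun=> 0); rewrite big1 // => j _; rewrite scale0r. Qed.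

Lemma in_spanD l u v : in_span l u -> in_span l v -> in_span l (u + v).
Proof.
move=> [c ->] [d ->]; exists (fun j => c j + d j).
by rewrite -big_split; apply: eq_bigr => j _; rewrite scalerDl.
Qed.

Lemma in_spanZ l a u : in_span l u -> in_span l (a *: u).
Proof.
move=> [c ->]; exists (fun j => a * c j).
by rewrite scaler_sumr; apply: eq_bigr => j _; rewrite scalerA.
Qed.

End Span.

(** Homogeneity enters only through the projections p1 and p2 of the algebra
    onto its parts of degrees 1 and 2; an element a is linear when
    p1 a = a. *)
Section KoszulFiltration.
Variables (A : comNzRingType) (p1 p2 : A -> A).
Hypothesis p1D : {morph p1 : x y / x + y}.
Hypothesis p2D : {morph p2 : x y / x + y}.
Hypothesis p1_id : forall a, p1 (p1 a) = p1 a.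
Hypothesis p2M : forall a g, p1 g = g -> p2 (a * g) = p1 a * g.

(** Ideals are represented by lists of generators, so in_span t over A^o is
    membership in the ideal of t.  Stating the condition for vectors of any
    module V lets the same definition cover the members of F, for V = A, and
    the rows of the matrices of the resolution. *)
Definition filtered (F : seq A^o -> Prop) (V : lmodType A) (lin : V -> Prop) :=
  stepwise (fun (l : seq V) g =>
    lin g /\ exists2 t, F t & forall a, in_span l (a *: g) <-> in_span t a).

Definition linear_row b (g : 'rV[A]_b) : Prop := forall j, p1 (g 0 j) = g 0 j.

Variable F : seq A^o -> Prop.
Hypothesis koszul_F : forall t, F t -> @filtered F A^o (fun a : A => p1 a = a) t.

Definition rows_mx b (l : seq 'rV[A]_b) : 'M[A]_(size l, b) :=
  \matrix_(i < size l) l`_i.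

Let p1_0 : p1 0 = 0.
Proof. by apply: (addrI (p1 0)); rewrite -p1D !addr0. Qed.

Let p2_0 : p2 0 = 0.
Proof. by apply: (addrI (p2 0)); rewrite -p2D !addr0. Qed.

Let p1N a : p1 (- a) = - p1 a.
Proof. by apply: (addrI (p1 a)); rewrite -p1D !subrr p1_0. Qed.

(** Lists of rows are convenient for inductions on prefixes, matrices for
    syzygies; this is the bridge between the two. *)
Lemma in_span_take b (l : seq 'rV[A]_b) k u : (k <= size l)%N ->
  in_span (take k l) u <-> exists2 v : 'rV_(size l),
    forall j : 'I_(size l), (k <= j)%N -> v 0 j = 0 & v *m rows_mx l = u.
Proof.
move=> le_kl.
have sumE (c : nat -> A) : \sum_(j < size (take k l)) c j *: (take k l)`_j =
    \sum_(j < size l | (j < k)%N) c j *: l`_j.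
  rewrite size_takel // (big_ord_widen _ (fun j => c j *: (take k l)`_j) le_kl).
  by apply: eq_bigr => j ltjk; rewrite nth_take.
split=> [[c ->]|[v v0 <-]].
  exists (\row_j if (j < k)%N then c j else 0) => [j|].
    by rewrite mxE ltnNge => ->.
  rewrite mulmx_sum_row sumE [RHS]big_mkcond /=; apply: eq_bigr => j _.
  by rewrite mxE rowK; case: ifP; rewrite ?scale0r.
pose c j := if insub j is Some i then v 0 i else 0.
exists c; rewrite mulmx_sum_row sumE [RHS]big_mkcond /=.
apply: eq_bigr => j _; rewrite rowK /c valK; case: ltnP => // /v0->.
by rewrite scale0r.
Qed.

(** A relation expressing y g_i through the earlier rows stays valid when its
    coefficients are replaced by their linear parts: compare the parts of
    degree 2 of both sides. *)
Lemma linear_syzygy b (l : seq 'rV[A]_b) (i : 'I_(size l)) y :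
    (forall g, g \in l -> linear_row g) -> p1 y = y ->
    in_span (take i l) (y *: l`_i) ->
  exists h : 'rV_(size l), [/\ linear_row h, h *m rows_mx l = 0, h 0 i = y
    & forall j : 'I_(size l), (i < j)%N -> h 0 j = 0].
Proof.
move=> lin_l lin_y /(in_span_take _ (ltnW (ltn_ord i)))[v v0 vE].
have lin_nth (j : 'I_(size l)) c : p1 (l`_j 0 c) = l`_j 0 c.
  by apply: lin_l; rewrite mem_nth.
pose h : 'rV_(size l) := \row_j (if j == i then y else - p1 (v 0 j)).
have hE : h = y *: delta_mx 0 i - map_mx p1 v.
  apply/rowP => j; rewrite !mxE eqxx /=; case: eqP => [->|_].
    by rewrite (v0 i) // p1_0 subr0 mulr1.
  by rewrite mulr0 sub0r.
exists h; split.
- by move=> j; rewrite mxE; case: ifP; rewrite // p1N p1_id.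
- rewrite hE mulmxBl -scalemxAl -rowE rowK; apply/eqP; rewrite subr_eq0.
  apply/eqP/rowP => c.
  have /(congr1 p2) : (v *m rows_mx l) 0 c = y * l`_i 0 c.
    by rewrite vE mxE.
  rewrite p2M // lin_y !mxE => <-; rewrite (big_morph p2 p2D p2_0).
  by apply: eq_bigr => j _; rewrite !mxE p2M.
- by rewrite mxE eqxx.
move=> j lt_ij; rewrite mxE v0 1?ltnW // p1_0 oppr0.
by case: eqP lt_ij => // ->; rewrite ltnn.
Qed.

Lemma filtered_all (V : lmodType A) (lin : V -> Prop) l :
  filtered F lin l -> forall g, g \in l -> lin g.
Proof. by move=> + g gl; case/splitPr: gl => l1 l2 lF; case: (lF _ _ _ erefl). Qed.

(** The engine of the resolution.  Syzygies supported on the first k rows are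
    treated by induction on k; the passage to k + 1 adds one linear syzygy
    for each generator y of the colon ideal of row k, whose coordinate at k
    is y.  Multiples of it lie in the span of the earlier ones exactly when
    their coordinate at k lies in the ideal of the earlier generators, so the
    colon ideals are those of the list of the y. *)
Lemma filtered_syzygies b (l : seq 'rV[A]_b) :
    filtered F (@linear_row b) l ->
  exists2 H : seq 'rV[A]_(size l), filtered F (@linear_row _) H
    & forall v, in_span H v <-> v *m rows_mx l = 0.
Proof.
move=> lF; have lin_l := filtered_all lF.
suff main k : (k <= size l)%N -> exists2 H : seq 'rV[A]_(size l),
    filtered F (@linear_row _) H & forall v, in_span H v <->
      v *m rows_mx l = 0 /\ forall j : 'I_(size l), (k <= j)%N -> v 0 j = 0.
  have [H HF HE] := main _ (leqnn _); exists H => // v.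
  rewrite HE; split=> [[]//|->]; split=> // j.
  by rewrite leqNgt ltn_ord.
elim: k => [|k IHk] lt_kl.
  exists [::] => [|v]; first exact: stepwise_nil.
  rewrite in_span_nil; split=> [->|[_ v0]].
    by rewrite mul0mx; split=> // j _; rewrite mxE.
  by apply/rowP => j; rewrite v0 ?mxE.
have [H0 H0F H0E] := IHk (ltnW lt_kl).
pose i := Ordinal lt_kl.
have [] := lF (take k l) l`_k (drop k.+1 l).
  by rewrite -drop_nth // cat_take_drop.
move=> lin_lk [t Ft tE].
have tF := koszul_F Ft.
(* The syzygies supported up to k whose coordinate at k is in the ideal of a
   prefix t1 of t; the empty prefix is the induction hypothesis, and for
   t1 = t the condition on the coordinate holds automatically. *)
have {H0 H0F H0E IHk} prefix t1 t2 : t = t1 ++ t2 ->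
  exists2 H : seq 'rV[A]_(size l), filtered F (@linear_row _) H
    & forall v, in_span H v <-> [/\ v *m rows_mx l = 0,
      forall j : 'I_(size l), (k < j)%N -> v 0 j = 0 & in_span t1 (v 0 i : A^o)].
  elim/last_ind: t1 t2 => [|t1 y IHt] t2 t_eq.
    exists H0 => // v; rewrite H0E.
    split=> [[-> v0]|[-> v0 /in_span_nil vi0]]; split=> //.
    - by move=> j /ltnW; apply: v0.
    - by apply/in_span_nil/v0.
    move=> j; rewrite leq_eqVlt => /predU1P[kj|/v0//].
    by rewrite -[RHS]vi0; congr (v 0 _); apply: val_inj.
  have [|H HF HE] := IHt (y :: t2); first by rewrite t_eq cat_rcons.
  rewrite cat_rcons in t_eq.
  have [lin_y [t' Ft' t'E]] := tF _ _ _ t_eq.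
  have y_t : y \in t by rewrite t_eq mem_cat mem_head orbT.
  have [|||h [lin_h h0 hi hj]] := @linear_syzygy _ l i y => //.
    by apply/tE/in_span_mem.
  exists (rcons H h).
    apply: stepwise_rcons => //; split=> //; exists t' => // a.
    rewrite HE -t'E mxE hi.
    split=> [[]//|yt1]; split=> //; first by rewrite -scalemxAl h0 scaler0.
    by move=> j /hj; rewrite mxE => ->; rewrite mulr0.
  move=> v; rewrite in_span_rcons.
  split=> [[a /HE[v1 v2 v3]]|[v1 v2 /in_span_rcons[a va]]].
    split.
    - by move/eqP: v1; rewrite mulmxBl -scalemxAl h0 scaler0 subr0 => /eqP.
    - by move=> j lt_kj; have := v2 j lt_kj; rewrite !mxE hj // mulr0 subr0.
    by apply/in_span_rcons; exists a; move: v3; rewrite !mxE hi.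
  exists a; apply/HE; split.
  - by rewrite mulmxBl v1 -scalemxAl h0 scaler0 subr0.
  - by move=> j lt_kj; rewrite !mxE hj // v2 // mulr0 subr0.
  by rewrite !mxE hi.
have [H HF HE] := prefix t [::] (esym (cats0 _)).
exists H => // v; rewrite HE; split=> [[]//|[v1 v2]]; split=> //.
apply/tE/(in_span_take _ (ltnW lt_kl)).
exists (v 0 i *: delta_mx 0 i - v) => [j le_kj|].
  rewrite !mxE eqxx /=; case: eqP => [->|]; first by rewrite mulr1 subrr.
  move=> /eqP; rewrite -val_eqE /= => ne_jk; rewrite (v2 j) ?mulr0 ?subrr //.
  by rewrite ltn_neqAle eq_sym ne_jk.
by rewrite mulmxBl v1 subr0 -scalemxAl -rowE rowK.
Qed.

Record stage := Stage {
  stage_rank : nat;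
  stage_rows : seq 'rV[A]_stage_rank;
  stage_filtered : filtered F (@linear_row _) stage_rows }.

(** The rank of the next stage reduces to the number of rows of the present
    one; this is what lets the matrices of the resolution compose. *)
Definition next_stage (S : stage) : stage :=
  let H := cid2 (filtered_syzygies (@stage_filtered S)) in Stage (s2valP H).

Lemma in_span_rows_mx b (l : seq 'rV[A]_b) v :
  in_span l v <-> exists w, v = w *m rows_mx l.
Proof.
rewrite -[l in in_span l _]take_size in_span_take //.
split=> [[w _ <-]|[w ->]]; exists w => // j.
by rewrite leqNgt ltn_ord.
Qed.

Lemma in_span_const_mx (t : seq A^o) (a : A) :
  in_span [seq const_mx x : 'rV[A]_1 | x <- t] (const_mx a) <-> in_span t a.
Proof.
have sumE (c : nat -> A) :
    \sum_(j < size [seq const_mx x : 'rV[A]_1 | x <- t])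
      c j *: [seq const_mx x : 'rV[A]_1 | x <- t]`_j =
    const_mx (\sum_(j < size t) c j * t`_j).
  rewrite size_map; apply/rowP => i; rewrite summxE mxE; apply: eq_bigr => j _.
  by rewrite (nth_map 0) // !mxE.
split=> [[c /rowP/(_ 0) c_eq]|[c ->]]; exists c; last by rewrite sumE.
by rewrite sumE !mxE in c_eq.
Qed.

(** The resolution starts with the list t as a column matrix, so that the
    cokernel of the first map is the quotient by the ideal of t. *)
Lemma linear_resolution t : F t ->
  exists (b : nat -> nat) (D : forall k, 'M[A]_(b k.+1, b k)),
  [/\ b 0%N = 1%N, forall k i j, p1 (D k i j) = D k i j,
      forall v : 'rV_(b 0%N),
        in_span t (\sum_j v 0 j : A^o) <-> exists w, v = w *m D 0%N
    & forall k (v : 'rV_(b k.+1)),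
        v *m D k = 0 <-> exists w, v = w *m D k.+1].
Proof.
move=> Ft.
have filt_t : filtered F (@linear_row 1) [seq const_mx x : 'rV[A]_1 | x <- t].
  move=> s1 g s2 t_eq; have [t1 [x [t2 [tE <- <-]]]] := map_split t_eq.
  have [lin_x [t' Ft' t'E]] := koszul_F Ft tE.
  split; first by move=> j; rewrite mxE.
  exists t' => // a; rewrite -t'E -in_span_const_mx.
  suff -> : a *: const_mx x = const_mx (a * x) :> 'rV_1 by [].
  by apply/rowP => j; rewrite !mxE.
pose st k := iter k next_stage (Stage filt_t).
exists (fun k => stage_rank (st k)), (fun k => rows_mx (stage_rows (st k))).
split=> //= [k i j|v|k v].
- by rewrite mxE; apply: (filtered_all (@stage_filtered (st k))); rewrite mem_nth.
- rewrite -in_span_rows_mx -in_span_const_mx big_ord1.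
  suff -> : const_mx (v 0 0) = v by [].
  by apply/rowP => j; rewrite mxE ord1.
have syzP := s2valP' (cid2 (filtered_syzygies (@stage_filtered (st k)))).
by rewrite -in_span_rows_mx /=; split=> /(syzP v).
Qed.
End KoszulFiltration.

(** * Koszul filtrations of wedges of lattice monoids *)

Section AddScaled.
Variables (V : zmodType) (g f : {additive V -> int}) (c : int).

Definition add_scaled v : int := g v + c * f v.

Fact add_scaled_morphism : zmod_morphism add_scaled.
Proof. by move=> v w; rewrite /add_scaled !raddfB /=; ring. Qed.

HB.instance Definition _ :=
  GRing.isZmodMorphism.Build V int add_scaled add_scaled_morphism.

End AddScaled.

Section MonoidFiltration.
Variables (V : zmodType) (deg : V -> int).

Definition ideal_gen (N : set V) (s : seq V) : set V :=
  [set w | exists2 u, u \in s & N (w - u)].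

Definition linear_step (N : set V) (F : set (set V)) (s : seq V) (u : V) :=
  [/\ N u, deg u = 1 & exists2 J, F J
     & forall w, N w -> ideal_gen N s (w + u) <-> J w].

(** A Koszul filtration of the monoid N: its members are ideals of N, but only
    their traces on N matter. *)
Definition koszul_family (N : set V) (F : set (set V)) : Prop :=
  forall I, F I -> exists2 s, stepwise (linear_step N F) s
    & forall w, N w -> ideal_gen N s w <-> I w.

(** The ideal where g is positive is the complement of a face of N; asking for
    all of these ideals is the invariant that survives the passage to a
    wedge. *)
Definition face_filtration (N : set V) (F : set (set V)) : Prop :=
  koszul_family N F /\ forall g : {additive V -> int},
    (forall w, N w -> 0 <= g w) ->
    exists2 I, F I & forall w, N w -> I w <-> 0 < g w.

Lemma ideal_gen_rcons N s u w :
  ideal_gen N (rcons s u) w <-> ideal_gen N s w \/ N (w - u).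
Proof.
split=> [[x]|[[x xs Nx]|Nu]].
- rewrite mem_rcons inE => /predU1P[->|xs] Nx; first by right.
  by left; exists x.
- by exists x; rewrite // mem_rcons inE xs orbT.
by exists u; rewrite // mem_rcons mem_head.
Qed.

End MonoidFiltration.

(** Splits the height of a point over y = u + (y - u) into a height over u and
    one over y - u. *)
Lemma split_height (h c d : int) : 0 <= h -> 0 <= c -> 0 <= d -> h <= c + d ->
  exists j : nat, [/\ j%:Z <= c, j%:Z <= h & h - j%:Z <= d].
Proof.
move=> h0 c0 d0 hcd; have [hc|ch] := lerP h c.
  by exists (absz h); split; lia.
by exists (absz c); split; lia.
Qed.

Section Wedge.
Variables (V : zmodType) (deg f p : {additive V -> int}) (e : V).
Variables (N N' : set V).
(* e is the new direction and p the coordinate along it; N' is the wedge over N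
   with roof f. *)
Hypotheses (pe : p e = 1) (fe : f e = 0) (dege : deg e = 0).
Hypothesis pN : forall u, N u -> p u = 0.
Hypothesis fN : forall u, N u -> 0 <= f u.
Hypothesis N0 : N 0.
Hypothesis ND : forall u v, N u -> N v -> N (u + v).

Definition foot v := v - e *~ p v.

Hypothesis N'E : forall v, N' v <-> N (foot v) /\ 0 <= p v <= f v.

(** The height is measured from the floor for b = true and downwards from the
    roof for b = false.  The wedge looks the same in both descriptions, which
    saves proving mirror images. *)
Definition height (b : bool) v := if b then p v else f v - p v.
Definition raised (b : bool) u j := u + e *~ (if b then j else f u - j).

Lemma footD v w : foot (v + w) = foot v + foot w.
Proof. by rewrite /foot raddfD mulrzDr opprD addrACA. Qed.

Lemma footB v w : foot (v - w) = foot v - foot w.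
Proof. by rewrite /foot raddfB mulrzBr !opprD !opprK addrACA. Qed.

Lemma heightD b v w : height b (v + w) = height b v + height b w.
Proof. by case: b; rewrite /height !raddfD //=; ring. Qed.

Lemma heightB b v w : height b (v - w) = height b v - height b w.
Proof. by case: b; rewrite /height !raddfB //=; ring. Qed.

Lemma f_foot v : f (foot v) = f v.
Proof. by rewrite /foot raddfB raddfMz fe mul0rz subr0. Qed.

Lemma p_raised b u j : N u -> p (raised b u j) = if b then j else f u - j.
Proof. by move=> Nu; rewrite /raised raddfD (raddfMz p) pe pN // add0r intz. Qed.

Lemma foot_raised b u j : N u -> foot (raised b u j) = u.
Proof. by move=> Nu; rewrite /foot p_raised // addrK. Qed.

Lemma f_raised b u j : f (raised b u j) = f u.
Proof. by rewrite /raised raddfD (raddfMz f) fe mul0rz addr0. Qed.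

Lemma height_raised b u j : N u -> height b (raised b u j) = j.
Proof.
by move=> Nu; rewrite /height f_raised p_raised //; case: b => //; ring.
Qed.

Lemma wedgeE b v : N' v <-> N (foot v) /\ 0 <= height b v <= f v.
Proof.
rewrite N'E; case: b => //=; split=> [] [? /andP[? ?]]; split=> //; lia.
Qed.

Lemma wedge_sub b v u j : N u ->
  N' (v - raised b u j) <->
    [/\ N (foot v - u), j <= height b v & height b v - j <= f v - f u].
Proof.
move=> Nu; rewrite (wedgeE b) footB foot_raised // heightB height_raised //.
rewrite raddfB f_raised subr_ge0.
by split=> [[? /andP[? ?]]|[? ? ?]]; split=> //; apply/andP.
Qed.

Definition off_facet b := [set v | height b v < f v].

Variable F : set (set V).

(** Preimages of members of F, possibly enlarged by the points off the top
    facet (b = true) or off the bottom facet (b = false). *)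
Definition wedge_family : set (set V) :=
  [set K | exists2 I, F I &
     K = foot @^-1` I \/ exists b, K = foot @^-1` I `|` off_facet b].

Hypothesis F_face : face_filtration deg N F.

Definition fiber b u m := [seq raised b u j%:Z | j <- iota 0 m].

Lemma fiberS b u m : fiber b u m.+1 = rcons (fiber b u m) (raised b u m%:Z).
Proof. by rewrite /fiber -[in LHS]addn1 iotaD map_cat cats1. Qed.

Lemma ideal_gen_fiber b s u m w : N u ->
  ideal_gen N' (s ++ fiber b u m) w <-> ideal_gen N' s w \/
    exists2 j : nat, (j < m)%N & [/\ N (foot w - u), j%:Z <= height b w
      & height b w - j%:Z <= f w - f u].
Proof.
move=> Nu; split=> [[x]|[[x xs Nx]|[j jm jP]]].
- rewrite mem_cat => /orP[xs|/mapP[j jm xE]] Nx; first by left; exists x.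
  right; exists j; first by rewrite mem_iota in jm.
  by apply/wedge_sub; rewrite // -xE.
- by exists x; rewrite // mem_cat xs.
exists (raised b u j); last exact/wedge_sub.
rewrite mem_cat; apply/orP; right; apply/mapP; exists j => //.
by rewrite mem_iota.
Qed.

(** The colon ideal at the point of height j over u: if j > 0, subtracting a
    lower point of the same fibre leaves a positive shift of the height, so
    exactly the points off the facet are added to what the earlier generators
    contribute. *)
Lemma fiber_stepwise b s u m (J : set V) :
    N u -> deg u = 1 -> F J -> m%:Z <= f u + 1 ->
    (forall j w, (j < m)%N -> N' w ->
       ideal_gen N' s (w + raised b u j%:Z) <-> J (foot w)) ->
  stepwise (linear_step deg N' wedge_family) s ->
  stepwise (linear_step deg N' wedge_family) (s ++ fiber b u m).
Proof.
move=> Nu degu FJ; elim: m => [|m IHm] mu sJ sF; first by rewrite cats0.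
rewrite fiberS -rcons_cat; apply: stepwise_rcons.
  by apply: IHm => // [|j w jm]; [lia | apply: sJ; lia].
split.
- apply/(wedgeE b); rewrite foot_raised // height_raised // f_raised.
  by split=> //; lia.
- by rewrite /raised raddfD raddfMz dege mul0rz addr0.
exists (foot @^-1` J `|` if (m == 0)%N then set0 else off_facet b).
  exists J => //; case: (m == 0)%N; first by left; rewrite setU0.
  by right; exists b.
move=> w N'w; rewrite ideal_gen_fiber // sJ //.
have /(wedgeE b)[Nw /andP[hw0 hw]] := N'w.
rewrite footD foot_raised // addrK heightD height_raised // raddfD f_raised.
split=> [[Jw|[j jm [_ _ hj]]]|[Jw|]]; [by left| | by left |].
  by right; case: eqP => [|_]; [lia | rewrite /off_facet /=; lia].
case: eqP => // m0; rewrite /off_facet /= => hlt.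
(* The generator just below height m shifts the height by exactly 1. *)
by right; exists m.-1; [lia | split=> //; lia].
Qed.

Lemma wedge_raised b u j : N u -> 0 <= j <= f u -> N' (raised b u j).
Proof.
move=> Nu jfu; apply/(wedgeE b).
by rewrite foot_raised // height_raised // f_raised.
Qed.

Lemma wedgeD v w : N' v -> N' w -> N' (v + w).
Proof.
move=> /N'E[Nv hv] /N'E[Nw hw]; apply/N'E; rewrite footD; split; first exact: ND.
rewrite !raddfD; lia.
Qed.

(** A point off the facet lies over some y with f(y) > 0, hence over u + z with
    u a generator of the ideal where f is positive, and the height can be
    split so that the part over u is not maximal. *)
Lemma off_facet_ideal b : exists2 s, stepwise (linear_step deg N' wedge_family) s
  & forall v, N' v -> ideal_gen N' s v <-> off_facet b v.
Proof.
have [I FI IE] := F_face.2 f fN; have [s s_steps sE'] := F_face.1 _ FI.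
have sE w : N w -> ideal_gen N s w <-> 0 < f w.
  by move=> Nw; rewrite sE' // IE.
have s_pos u : N u -> u \in s -> 0 < f u.
  by move=> Nu us; apply/(sE u Nu); exists u; rewrite // subrr.
pose lifts s1 := exists2 s', stepwise (linear_step deg N' wedge_family) s'
  & forall v, N' v ->
    ideal_gen N' s' v <-> ideal_gen N s1 (foot v) /\ off_facet b v.
suff [s' s'_steps s'E] : lifts s.
  exists s' => // v N'v; rewrite s'E //; split=> [[]//|hv]; split=> //.
  have /(wedgeE b)[Nv hbv] := N'v.
  by apply/(sE _ Nv); rewrite f_foot; move: hv; rewrite /off_facet /=; lia.
apply: (stepwise_ind s_steps) => [|s1 u us [Nu degu [J FJ JE]] [s' s'_steps s'E]].
  exists [::] => [|v N'v]; first exact: stepwise_nil.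
  by split=> [[]//|[[]]].
have fu_gt0 := s_pos _ Nu us.
exists (s' ++ fiber b u `|f u|%N).
  apply: (fiber_stepwise _ _ FJ) => // [|j w ju N'w]; first lia.
  have N'u : N' (raised b u j) by apply: wedge_raised; rewrite //; lia.
  rewrite s'E; last exact: wedgeD.
  have /(wedgeE b)[Nw hw] := N'w.
  rewrite footD foot_raised // JE //; split=> [[]//|]; split=> //.
  by rewrite /off_facet /= heightD height_raised // raddfD f_raised; lia.
move=> v N'v; have /(wedgeE b)[Nv /andP[hv0 hv]] := N'v.
rewrite ideal_gen_fiber // s'E // ideal_gen_rcons.
split=> [[[]|[j ju [Nvu hj1 hj2]]]|[[?|Nvu] hr]].
- by split; first left.
- by split; [right | rewrite /off_facet /=; lia].
- by left.
have := fN Nvu; rewrite raddfB f_foot => fvu; rewrite /off_facet /= in hr.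
have [||||j [ju jv jvu]] := @split_height (height b v) (f u - 1) (f v - f u) => //.
- by lia.
- by lia.
by right; exists j; [lia | split].
Qed.

(** For an enlarged ideal the points off the facet come first; what remains of
    each fibre is its extreme point of height f(u).  Adding it to a point does
    not change whether that point is off the facet, so the colon ideal is
    enlarged by the same points. *)
Lemma wedge_koszul : koszul_family deg N' wedge_family.
Proof.
move=> K [I FI]; have [s s_steps sE] := F_face.1 _ FI.
case=> [->|[b ->]].
  pose lifts s1 := exists2 s', stepwise (linear_step deg N' wedge_family) s'
    & forall v, N' v -> ideal_gen N' s' v <-> ideal_gen N s1 (foot v).
  suff [s' s'_steps s'E] : lifts s.
    exists s' => // v N'v; rewrite s'E //.
    by have /N'E[Nv _] := N'v; rewrite sE.
  apply: (stepwise_ind s_steps) => [|s1 u _ [Nu degu [J FJ JE]] [s' s'_steps s'E]].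
    exists [::] => [|v N'v]; first exact: stepwise_nil.
    by split=> [[]|[]].
  have fu_ge0 := fN Nu.
  exists (s' ++ fiber true u `|f u|.+1).
    apply: (fiber_stepwise _ _ FJ) => // [|j w ju N'w]; first lia.
    have N'u : N' (raised true u j) by apply: wedge_raised; rewrite //; lia.
    rewrite s'E; last exact: wedgeD.
    by have /N'E[Nw _] := N'w; rewrite footD foot_raised // JE.
  move=> v N'v; have /(wedgeE true)[Nv /andP[hv0 hv]] := N'v.
  rewrite ideal_gen_fiber // s'E // ideal_gen_rcons.
  split=> [[?|[j ju [Nvu hj1 hj2]]]|[?|Nvu]]; [by left|by right|by left|right].
  have := fN Nvu; rewrite raddfB f_foot => fvu.
  have [||||j [ju jv jvu]] := @split_height (height true v) (f u) (f v - f u) => //.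
    by lia.
  by exists j; [lia | split].
pose lifts s1 := exists2 s', stepwise (linear_step deg N' wedge_family) s'
  & forall v, N' v ->
    ideal_gen N' s' v <-> ideal_gen N s1 (foot v) \/ off_facet b v.
suff [s' s'_steps s'E] : lifts s.
  exists s' => // v N'v; rewrite s'E //.
  by have /N'E[Nv _] := N'v; rewrite sE.
apply: (stepwise_ind s_steps) => [|s1 u _ [Nu degu [J FJ JE]] [s' s'_steps s'E]].
  have [s' s'_steps s'E] := off_facet_ideal b; exists s' => // v N'v.
  by rewrite s'E //; split=> [|[[]|]] //; right.
have fu_ge0 := fN Nu.
have N'u : N' (raised b u (f u)) by apply: wedge_raised; rewrite // fu_ge0 lexx.
exists (rcons s' (raised b u (f u))).
  apply: stepwise_rcons => //; split=> //.
    by rewrite /raised raddfD (raddfMz deg) dege mul0rz addr0.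
  exists (foot @^-1` J `|` off_facet b) => [|w N'w].
    by exists J => //; right; exists b.
  rewrite s'E; last exact: wedgeD.
  have /N'E[Nw _] := N'w; rewrite footD foot_raised // JE //.
  by rewrite /off_facet /= heightD height_raised // raddfD f_raised ltrD2r.
move=> v N'v; have /(wedgeE b)[Nv /andP[hv0 hv]] := N'v.
rewrite ideal_gen_rcons s'E // ideal_gen_rcons wedge_sub // /off_facet /=.
split=> [[[]|[]]|[[]|]].
- by left; left.
- by right.
- by left; right.
- by left; left.
- move=> Nvu; have := fN Nvu; rewrite raddfB f_foot subr_ge0 => fvu.
  have [?|hv'] := ltrP (height b v) (f v); first by left; right.
  by right; split; rewrite ?lerD2r // (le_trans fvu).
by left; right.
Qed.

(** If g decreases along e, rewrite it from the roof: it is g + g(e) f at the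
    foot plus -g(e) times the distance to the roof.  Both summands are
    nonnegative, so g is positive exactly when one of them is. *)
Lemma wedge_filtration : face_filtration deg N' wedge_family.
Proof.
split; first exact: wedge_koszul.
move=> g g_ge0.
have N_wedge u : N u -> N' u.
  by move=> Nu; apply/N'E; rewrite /foot pN // mulr0z subr0 lexx fN.
have gE v : g v = g (foot v) + g e * p v.
  have {1}-> : v = foot v + e *~ p v by rewrite subrK.
  by rewrite raddfD (raddfMz g) mulrzz.
have [e_neg|e_pos|e0] := ltgtP (g e) 0.
- have g_top u : N u -> 0 <= add_scaled g f (g e) u.
    move=> Nu; have fu := fN Nu.
    have := g_ge0 _ (@wedge_raised true u (f u) Nu _); rewrite fu lexx => /(_ isT).
    by rewrite gE foot_raised // p_raised.
  have [I FI IE] := F_face.2 _ g_top.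
  exists (foot @^-1` I `|` off_facet true); first by exists I => //; right; exists true.
  move=> v /N'E[Nv /andP[pv0 pvf]].
  have := g_top _ Nv; have := IE _ Nv.
  rewrite (gE v) /off_facet /= /add_scaled f_foot => IEv gv0.
  have gvE : g (foot v) + g e * p v =
      g (foot v) + g e * f v + - g e * (f v - p v) by ring.
  rewrite gvE; split=> [[/IEv gv|pv]|gv].
  + by rewrite ltr_pwDl // mulr_ge0 ?subr_ge0 // oppr_ge0 ltW.
  + by rewrite ltr_wpDl // mulr_gt0 ?subr_gt0 // oppr_gt0.
  have [pv|fpv] := ltrP (p v) (f v); [by right | left; apply/IEv; move: gv].
  by have -> : p v = f v; [apply/eqP; rewrite eq_le pvf | rewrite subrr mulr0 addr0].
- have g_bot u : N u -> 0 <= g u by move/N_wedge/g_ge0.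
  have [I FI IE] := F_face.2 _ g_bot.
  exists (foot @^-1` I `|` off_facet false); first by exists I => //; right; exists false.
  move=> v /N'E[Nv /andP[pv0 pvf]].
  have := g_bot _ Nv; have := IE _ Nv; rewrite (gE v) /off_facet /= => IEv gv0.
  rewrite ltrBlDr ltrDl; split=> [[/IEv gv|pv]|gv].
  + by rewrite ltr_pwDl // mulr_ge0 // ltW.
  + by rewrite ltr_wpDl // mulr_gt0.
  have [?|pv] := ltrP 0 (p v); [by right | left; apply/IEv; move: gv].
  by have -> : p v = 0; [apply/eqP; rewrite eq_le pv | rewrite mulr0 addr0].
have g_bot u : N u -> 0 <= g u by move/N_wedge/g_ge0.
have [I FI IE] := F_face.2 _ g_bot.
exists (foot @^-1` I); first by exists I => //; left.
by move=> v /N'E[Nv _]; rewrite (gE v) e0 mul0r addr0; apply: IE.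
Qed.

End Wedge.

Section Ray.
Variables (V : zmodType) (deg : {additive V -> int}) (e : V).
Hypothesis dege : deg e = 1.

(** The polynomial ring in one variable: the filtration consists of the zero
    ideal and the maximal one. *)
Lemma ray_filtration (N : set V) :
    (forall v, N v <-> v = e *~ deg v /\ 0 <= deg v) ->
  exists F, face_filtration deg N F.
Proof.
move=> NE; exists [set set0; [set v | 0 < deg v]].
have Ne : N e by apply/NE; rewrite dege mulr1z.
split=> [I [->|->]|g g_ge0].
- by exists [::] => [|v _]; [exact: stepwise_nil | split=> [[]|]].
- exists [:: e] => [|v /NE[vE v0]].
    apply: (@stepwise_rcons _ _ [::]); first exact: stepwise_nil.
    split=> //; exists set0; first by left.
    by move=> w _; split=> [[]|].
  split=> [[_ /predU1P[->|//]] /NE[_]|v_gt0].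
    by rewrite raddfB dege subr_ge0; apply: lt_le_trans.
  exists e; first exact: mem_head.
  apply/NE; rewrite raddfB dege /= mulrzBr mulr1z -vE; split=> //.
  by rewrite subr_ge0 -gtz0_ge1.
have gE v : N v -> g v = g e * deg v.
  by move=> /NE[vE _]; rewrite {1}vE (raddfMz g) mulrzz.
have [ge0|ge_gt0] := eqVneq (g e) 0.
  by exists set0; [left | move=> v Nv; rewrite gE // ge0 mul0r ltxx].
exists [set v | 0 < deg v]; first by right.
by move=> v Nv; rewrite gE // pmulr_rgt0 // lt_neqAle eq_sym ge_gt0 g_ge0.
Qed.

End Ray.

(** * Nakajima polytopes and their cones *)

Section NakajimaCone.
Variables (n : nat) (m : seq 'rV[int]_n.+1).

Definition axis (k : nat) : 'I_n.+1 := inord k.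

Definition linform (S : numDomainType) (r : 'rV[int]_n.+1) (x : 'cV[S]_n.+1) : S :=
  \sum_j (r 0 j)%:~R * x j 0.

(** The inequalities 0 <= x_(i+1) <= <m_i, x> of the cone over the polytope,
    over any ordered ring of scalars so that they apply to real points and to
    lattice points alike. *)
Fixpoint nakajima_cone (S : numDomainType) (k : nat) : set 'cV[S]_n.+1 :=
  if k is k'.+1 then
    [set x : 'cV[S]_n.+1 |
       nakajima_cone k' (x - x (axis k) 0 *: delta_mx (axis k) 0) /\
       0 <= x (axis k) 0 <= linform m`_k' x]
  else [set x : 'cV[S]_n.+1 | x = x ord0 0 *: delta_mx ord0 0 /\ 0 <= x ord0 0].

Lemma linformD (S : numDomainType) r (x y : 'cV[S]_n.+1) :
  linform r (x + y) = linform r x + linform r y.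
Proof. by rewrite -big_split; apply: eq_bigr => j _; rewrite mxE mulrDr. Qed.

Lemma linformZ (S : numDomainType) r a (x : 'cV[S]_n.+1) :
  linform r (a *: x) = a * linform r x.
Proof. by rewrite mulr_sumr; apply: eq_bigr => j _; rewrite mxE mulrCA. Qed.

Lemma linform0 (S : numDomainType) r : linform r (0 : 'cV[S]_n.+1) = 0.
Proof. by rewrite -(scale0r (0 : 'cV[S]_n.+1)) linformZ mul0r. Qed.

Lemma linform_delta (S : numDomainType) r j :
  linform r (delta_mx j 0 : 'cV[S]_n.+1) = (r 0 j)%:~R.
Proof.
rewrite /linform (bigD1 j) //= mxE !eqxx mulr1 big1 ?addr0 // => i /negPf ij.
by rewrite mxE ij mulr0.
Qed.

Section ConeFacts.
Variable S : numDomainType.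
Implicit Types (x y : 'cV[S]_n.+1).

Lemma nakajima_coneD k x y :
  nakajima_cone k x -> nakajima_cone k y -> nakajima_cone k (x + y).
Proof.
elim: k x y => [|k IHk] x y /=.
  by rewrite mxE => [] [-> ?] [-> ?]; split; rewrite ?addr_ge0 // !mxE /= !mulr1 -scalerDl.
move=> [xC /andP[x0 xf]] [yC /andP[y0 yf]]; split.
  by rewrite mxE scalerDl opprD addrACA; apply: IHk.
by rewrite mxE linformD addr_ge0 // lerD.
Qed.

Lemma nakajima_coneZ k a x : 0 <= a ->
  nakajima_cone k x -> nakajima_cone k (a *: x).
Proof.
move=> a0; elim: k x => [|k IHk] x /=.
  by move=> [xE x0]; split; rewrite mxE ?mulr_ge0 // {1}xE scalerA.
move=> [xC /andP[x0 xf]]; split; last by rewrite mxE linformZ mulr_ge0 // ler_wpM2l.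
by rewrite mxE -scalerA -scalerBr; apply: IHk.
Qed.

Lemma nakajima_cone0 k : nakajima_cone k (0 : 'cV[S]_n.+1).
Proof.
elim: k => [|k IHk] /=; first by rewrite mxE scale0r.
by rewrite mxE scale0r subr0 linform0 lexx.
Qed.

Lemma nakajima_cone_above k x : nakajima_cone k x -> (k <= n)%N ->
  forall j : 'I_n.+1, (k < j)%N -> x j 0 = 0.
Proof.
elim: k x => [|k IHk] x /=.
  move=> [-> _] _ j j0; rewrite !mxE /=.
  by case: eqP j0 => [->|]; rewrite ?ltnn // mulr0.
move=> [xC _] kn j kj; have := IHk _ xC (ltnW kn) j (ltnW kj).
rewrite !mxE /=; case: eqP kj => [->|_ _]; first by rewrite inordK // ltnn.
by rewrite mulr0 subr0.
Qed.

Lemma nakajima_cone_deg_ge0 k x : nakajima_cone k x -> (k <= n)%N -> 0 <= x ord0 0.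
Proof.
elim: k x => [|k IHk] x /= [xC] // _ kn.
have := IHk _ xC (ltnW kn); rewrite !mxE -val_eqE /= inordK //.
by rewrite mulr0 subr0.
Qed.

Lemma nakajima_cone_deg0 k x : nakajima_cone k x -> (k <= n)%N ->
  (forall i, (i < k)%N -> m`_i 0 (axis i.+1) = 0) ->
  x ord0 0 = 0 -> x = 0.
Proof.
elim: k x => [|k IHk] x /=.
  by move=> [-> _] _ _; rewrite !mxE /= mulr1 => ->; rewrite scale0r.
move=> [xC /andP[x0 xf]] kn m0 xd.
have x_eq : x = x (axis k.+1) 0 *: delta_mx (axis k.+1) 0.
  apply/eqP; rewrite -subr_eq0; apply/eqP/IHk => //; first exact: ltnW.
    by move=> i ik; apply: m0; apply: ltnW.
  by rewrite !mxE xd -val_eqE /= inordK // mulr0 subr0.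
move: xf; rewrite {2}x_eq linformZ linform_delta m0 // mulr0z mulr0 => xf.
have {}x0 : x (axis k.+1) 0 = 0 by apply/eqP; rewrite eq_le x0 xf.
by rewrite x_eq x0 scale0r.
Qed.

End ConeFacts.

Lemma linform_intvec (R : realType) r (z : 'cV[int]_n.+1) :
  linform r (intvec R z) = (linform r z)%:~R.
Proof. by rewrite rmorph_sum; apply: eq_bigr => j _; rewrite mxE /= intrM intz. Qed.

Lemma nakajima_cone_intvec (R : realType) k (z : 'cV[int]_n.+1) :
  nakajima_cone k (intvec R z) <-> nakajima_cone k z.
Proof.
have intvecE (w : 'cV[int]_n.+1) j :
    intvec R w - intvec R w j 0 *: delta_mx j 0 = intvec R (w - w j 0 *: delta_mx j 0).
  by apply/colP => i; rewrite !mxE intrD intrN intrM; case: (i == j).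
elim: k z => [|k IHk] z /=.
  rewrite mxE ler0z; split=> [] [zE ?]; split=> //.
    apply/colP => i; have /colP/(_ i) := zE; rewrite !mxE.
    case: (i == ord0) => /=; rewrite ?mulr1 ?mulr0 => /eqP.
      by rewrite eqr_int => /eqP.
    by rewrite intr_eq0 => /eqP.
  by rewrite {1}zE; apply/colP => i; rewrite !mxE intrM; case: (i == ord0).
by rewrite intvecE IHk linform_intvec mxE ler0z ler_int.
Qed.

Hypotheses (size_m : (size m <= n)%N) (free_m : free_parameters m).

Lemma free_next i : (i < size m)%N -> m`_i 0 (axis i.+1) = 0.
Proof.
move=> im; have [_] := free_m im; apply.
by rewrite inordK // ltnS (leq_trans im).
Qed.

(** Since m_k does not involve the coordinate k + 1, moving along that axis
    changes neither the bound nor the earlier inequalities: the cone is a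
    wedge over the previous one. *)
Lemma nakajima_coneS (S : numDomainType) k (x : 'cV[S]_n.+1) t :
  (k < size m)%N -> nakajima_cone k x ->
  nakajima_cone k.+1 (x + t *: delta_mx (axis k.+1) 0) <-> 0 <= t <= linform m`_k x.
Proof.
move=> km xC; have kn : (k < n)%N by apply: leq_trans km size_m.
have xk : x (axis k.+1) 0 = 0.
  by apply: (nakajima_cone_above xC); rewrite ?inordK // ltnW.
rewrite /= linformD linformZ linform_delta free_next // mulr0z mulr0 addr0.
by rewrite !mxE !eqxx mulr1 xk add0r addrK; split=> [[]|].
Qed.

Section Polytope.
Variable R : realType.
Hypothesis adm_m : admissible R m.

Lemma raiseE k (x : 'cV[R]_n.+1) : (k < size m)%N -> nakajima_cone k x ->
  raise k.+1 m`_k x = x + linform m`_k x *: delta_mx (axis k.+1) 0.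
Proof.
move=> km xC; have kn : (k < n)%N by apply: leq_trans km size_m.
have x_above := nakajima_cone_above xC (ltnW kn).
apply/colP => j; rewrite !mxE -val_eqE /= inordK // andbT.
case: ltngtP => jk; rewrite ?mulr0 ?addr0 // ?mulr1.
  by rewrite x_above // ltnW.
by rewrite x_above ?jk // add0r.
Qed.

(** A point x of the wedge lies on the vertical segment between the point y
    below it and the raised point of y, which gives it as a convex
    combination; the ratio is the height of x over the height of the
    segment. *)
Lemma nakajima_polytopeE k : (k <= size m)%N ->
  nakajima_polytope m k = [set x : 'cV[R]_n.+1 | nakajima_cone k x /\ x ord0 0 = 1].
Proof.
elim: k => [|k IHk] km.
  apply/seteqP; split=> x /=; first by move=> ->; rewrite !mxE scale1r.
  by move=> [[-> _]]; rewrite !mxE /= mulr1 => ->; rewrite scale1r.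
have kn : (k < n)%N by apply: leq_trans km size_m.
have pairing_ge0 (x : 'cV[R]_n.+1) : nakajima_polytope m k x -> 0 <= linform m`_k x.
  exact: adm_m.
have coneS := nakajima_coneS _ km.
have deg_e (t : R) : (t *: delta_mx (axis k.+1) 0 : 'cV[R]_n.+1) ord0 0 = 0.
  by rewrite !mxE -val_eqE /= inordK // mulr0.
apply/seteqP; split=> x.
  move=> [N [c [p [c0 c1 pP ->]]]].
  have pC i : nakajima_cone k.+1 (p i) /\ p i ord0 0 = 1.
    have [pi|[y yP <-]] : nakajima_polytope m k (p i) \/
      (raise k.+1 m`_k @` nakajima_polytope m k) (p i) := pP i.
      move: (pi); rewrite IHk 1?ltnW // => - [piC pi1]; split=> //.
      rewrite -[p i]addr0 -(scale0r (delta_mx (axis k.+1) 0)).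
      by apply/coneS; rewrite // lexx pairing_ge0.
    move: (yP); rewrite IHk 1?ltnW // => - [yC y1]; rewrite raiseE //.
    split; last by rewrite mxE deg_e addr0.
    by apply/coneS; rewrite // lexx pairing_ge0.
  split.
    apply: big_ind => [||i _]; first exact: nakajima_cone0.
      exact: nakajima_coneD.
    by apply: nakajima_coneZ => //; case: (pC i).
  rewrite summxE -c1; apply: eq_bigr => i _.
  by rewrite mxE (pC i).2 mulr1.
move=> [[yC /andP[t0 tf]] x1].
set t := x (axis k.+1) 0 in yC t0 tf.
set y := x - t *: delta_mx (axis k.+1) 0 in yC.
have yP : nakajima_polytope m k y.
  by rewrite IHk 1?ltnW //; split; rewrite // /y mxE [X in _ + X]mxE deg_e oppr0 addr0.
have xE : x = y + t *: delta_mx (axis k.+1) 0 by rewrite subrK.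
have fE : linform m`_k x = linform m`_k y.
  by rewrite xE linformD linformZ linform_delta free_next // mulr0z mulr0 addr0.
rewrite fE in tf; set f := linform m`_k y in fE tf.
have f0 : 0 <= f by exact: pairing_ge0.
(* For f = 0 the segment is a point; then t = 0 and t / f = 0 by convention. *)
have tE : t = t / f * f.
  have [f_eq0|f_neq0] := eqVneq f 0; last by rewrite divfK.
  by apply/eqP; rewrite f_eq0 mulr0 eq_le t0 -f_eq0 tf.
pose Q : set 'cV[R]_n.+1 :=
  nakajima_polytope m k `|` raise k.+1 m`_k @` nakajima_polytope m k.
have sub_conv (z : 'cV[R]_n.+1) : Q z -> conv Q z.
  move=> Pz; exists 1%N, (fun=> 1), (fun=> z); split=> //.
    by rewrite big_ord1.
  by rewrite big_ord1 scale1r.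
have -> : x = t / f *: raise k.+1 m`_k y + (1 - t / f) *: y.
  rewrite raiseE // scalerDr scalerA -/f -tE scalerBl scale1r.
  by rewrite addrAC [_ + (y - _)]addrC subrK.
apply: conv_convex.
- by rewrite divr_ge0.
- have [->|f_neq0] := eqVneq f 0; first by rewrite invr0 mulr0.
  by rewrite ler_pdivrMr ?mul1r // lt_def f_neq0.
- by apply: sub_conv; right; exists y.
by apply: sub_conv; left.
Qed.

Lemma nakajima_cone_tau k : (k <= size m)%N ->
  forall y : 'cV[R]_n.+1, tau (nakajima_polytope m k) y -> nakajima_cone k y.
Proof.
move=> km y [a [x [a0 + ->]]]; rewrite nakajima_polytopeE // => - [xC _].
exact: nakajima_coneZ.
Qed.

Lemma nakajima_cone_scale k (x : 'cV[R]_n.+1) : (k <= size m)%N ->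
  nakajima_cone k x -> x = 0 \/ 0 < x ord0 0 /\
    nakajima_polytope m k ((x ord0 0)^-1 *: x).
Proof.
move=> km xC; have kn := leq_trans km size_m.
have x0 := nakajima_cone_deg_ge0 xC kn.
have [xd|x_neq0] := eqVneq (x ord0 0) 0; [left|right].
  by apply: (nakajima_cone_deg0 xC) => // i ik; apply/free_next/(leq_trans ik).
split; first by rewrite lt_def x_neq0.
rewrite nakajima_polytopeE //; split; last by rewrite mxE mulVf.
by apply: nakajima_coneZ; rewrite // invr_ge0.
Qed.

(** Admissibility speaks of the polytope; by homogeneity it extends to the
    cone. *)
Lemma admissible_int k (z : 'cV[int]_n.+1) : (k < size m)%N ->
  nakajima_cone k z -> 0 <= linform m`_k z.
Proof.
move=> km /(nakajima_cone_intvec R)/(nakajima_cone_scale (ltnW km))[z0|[z_gt0 zP]].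
  by rewrite -(ler0z R) -linform_intvec z0 linform0.
have := adm_m km zP.
rewrite -[pairing _ _]/(linform m`_k _) linformZ pmulr_rge0 ?invr_gt0 //.
by rewrite linform_intvec ler0z.
Qed.

End Polytope.

Definition coord (i : 'I_n.+1) (v : 'cV[int]_n.+1) : int := v i 0.

Fact coord_morphism i : zmod_morphism (coord i).
Proof. by move=> v w; rewrite /coord !mxE. Qed.

HB.instance Definition _ i :=
  GRing.isZmodMorphism.Build 'cV[int]_n.+1 int (coord i) (coord_morphism i).

Fact linform_morphism r : zmod_morphism (@linform int r).
Proof.
by move=> v w; rewrite linformD -[- w]scaleN1r linformZ mulN1r.
Qed.

HB.instance Definition _ r :=
  GRing.isZmodMorphism.Build 'cV[int]_n.+1 int (@linform int r)
    (linform_morphism r).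

Lemma nakajima_filtration (R : realType) k : admissible R m -> (k <= size m)%N ->
  exists F, face_filtration (coord ord0) (@nakajima_cone int k) F.
Proof.
move=> adm_m; have scaleE j (v : 'cV[int]_n.+1) :
    v j 0 *: delta_mx j 0 = (delta_mx j 0 : 'cV[int]_n.+1) *~ coord j v.
  by rewrite -scaler_int intz.
elim: k => [|k IHk] km.
  apply: (@ray_filtration _ (coord ord0) (delta_mx ord0 0)).
    by rewrite -[LHS]/(coord _ _) /coord mxE.
  by move=> v /=; rewrite scaleE.
have kn : (k < n)%N by apply: leq_trans km size_m.
have [F F_face] := IHk (ltnW km).
exists (wedge_family (linform m`_k) (coord (axis k.+1)) (delta_mx (axis k.+1) 0) F).
apply: (@wedge_filtration _ _ _ _ _ (@nakajima_cone int k)) => //.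
- by rewrite /= /coord mxE !eqxx.
- by rewrite /= linform_delta free_next ?mulr0z.
- by rewrite /= /coord mxE -val_eqE /= inordK.
- move=> u uN; apply: (nakajima_cone_above uN); rewrite ?inordK //; exact: ltnW.
- by move=> u; apply: (admissible_int adm_m).
- exact: nakajima_cone0.
- by move=> u v; apply: nakajima_coneD.
by move=> v /=; rewrite scaleE.
Qed.

End NakajimaCone.

(** * Lattice points of a polytope equivalent to a Nakajima polytope *)

Section LatticePoints.
Variables (R : realType) (n : nat) (P : set 'cV[R]_n.+1).
Hypotheses (hP : lattice_polytope P) (hH : P `<=` Hbar R n).

Lemma aff_line k (S : set 'cV[R]_k) t x y :
  S x -> S y -> aff S (t *: x + (1 - t) *: y).
Proof.
move=> Sx Sy; exists 2%N, (fun i => if i == 0 then t else 1 - t).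
exists (fun i => if i == 0 then x else y); split.
- by rewrite !big_ord_recl big_ord0 /= addr0 addrC subrK.
- by move=> i; case: ifP.
by rewrite !big_ord_recl big_ord0 /= addr0.
Qed.

Lemma aff_subset k (S : set 'cV[R]_k) x : S x -> aff S x.
Proof.
by move=> Sx; have := aff_line 1 Sx Sx; rewrite subrr scale0r addr0 scale1r.
Qed.

Lemma tauP y : tau P y ->
  exists2 x, P x & y = y ord0 0 *: x.
Proof.
move=> [a [x [_ Px ->]]]; exists x => //.
by rewrite mxE (hH Px) mulr1.
Qed.

Lemma tau_deg_ge0 y : tau P y -> 0 <= y ord0 0.
Proof. by move=> [a [x [a0 Px ->]]]; rewrite mxE (hH Px) mulr1. Qed.

(** The affine equivalence phi extends to a linear map L on the cone over P.  It
    maps lattice points to lattice points because, z0 being a lattice point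
    of P, any lattice point of degree k in the cone is the sum of (k - 1) z0
    and a lattice point of the affine hull of P. *)
Lemma nakajima_lattice_points : is_nakajima P ->
  exists (m : seq 'rV[int]_n.+1) (psi : cone_monoid hP hH -> 'cV[int]_n.+1),
  [/\ [/\ (size m <= n)%N, free_parameters m & admissible R m],
      injective psi,
      forall x y, psi (cone_mul x y) = psi x + psi y,
      forall x, psi x ord0 0 = val x ord0 0
    & forall w, nakajima_cone m (size m) w <-> exists x, psi x = w].
Proof.
move=> [m [size_m free_m adm_m [A [b]]]].
set phi := fun x => A *m x + b => - /= [[phi_aff phi_inj _] phi_P [phi_lat _ phi_surj]].
set P2 := nakajima_polytope m (size m) in phi_aff phi_P phi_lat phi_surj.
have P2_deg x : P2 x -> x ord0 0 = 1.
  by rewrite /P2 nakajima_polytopeE // => - [].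
pose L (y : 'cV[R]_n.+1) := A *m y + y ord0 0 *: b.
have LD x y : L (x + y) = L x + L y.
  by rewrite /L mulmxDr mxE scalerDl addrACA.
have LZ a x : L (a *: x) = a *: L x.
  by rewrite /L -scalemxAr mxE -scalerA scalerDr.
have L_phi (x : 'cV[R]_n.+1) : x ord0 0 = 1 -> L x = phi x by move=> x1; rewrite /L x1 scale1r.
have P2_phi x : P x -> P2 (phi x) by move=> Px; rewrite -phi_P; exists x.
have [z0 Pz0] : exists z, P (intvec R z).
  have [[|z s] [// _ ->]] := hP; exists z; exists 1%N, (fun=> 1), (fun=> intvec R z).
  split=> //; rewrite ?big_ord1 ?scale1r // => _.
  by exists z => //=; rewrite mem_head.
have [w0 _ w0E] : lattice R _ (phi (intvec R z0)).
  have [|_] := phi_lat (intvec R z0); last by [].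
  by split; [exact: aff_subset | exists z0].
have line_deg t (x y : 'cV[R]_n.+1) : P x -> P y -> (t *: x + (1 - t) *: y) ord0 0 = 1.
  by move=> Px Py; rewrite !mxE (hH Px) (hH Py) !mulr1 addrC subrK.
(* With t the degree of z, the point z - (t - 1) z0 is a lattice point of
   aff P, so phi maps it to a lattice point. *)
have L_int (z : cone_monoid hP hH) : exists w, intvec R w = L (intvec R (val z)).
  have [x Px xE] := tauP (asboolW (valP z)).
  set t := intvec R (val z) ord0 0 in xE.
  have [|_ [w _ wE]] := phi_lat (t *: x + (1 - t) *: intvec R z0).
    split; first exact: aff_line.
    rewrite -xE; exists (val z + (1 - val z ord0 0) *: z0) => //.
    by apply/colP => i; rewrite /t !mxE intrD intrM intrB.
  rewrite -L_phi ?line_deg // LD !LZ (L_phi (intvec R z0)) ?(hH Pz0) // -w0E in wE.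
  exists (w + (val z ord0 0 - 1) *: w0).
  have -> : intvec R (w + (val z ord0 0 - 1) *: w0) = intvec R w + (t - 1) *: intvec R w0.
    by apply/colP => i; rewrite /t !mxE intrD intrM intrB.
  by rewrite wE xE LZ -addrA -scalerDl addrA subrK subrr scale0r addr0.
have [psi psiE] := choice L_int.
have psi_deg x : psi x ord0 0 = val x ord0 0.
  have [y Py yE] := tauP (asboolW (valP x)).
  apply/eqP; rewrite -(eqr_int R); apply/eqP.
  have -> : (psi x ord0 0)%:~R = intvec R (psi x) ord0 0 by rewrite mxE.
  rewrite psiE yE LZ L_phi ?(hH Py) // mxE (P2_deg (phi y)); last exact: P2_phi.
  by rewrite mulr1 mxE.
exists m, psi; split=> //.
- move=> x y xy; have := psi_deg x; rewrite xy psi_deg => deg_yx.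
  have /(congr1 (intvec R)) := xy; rewrite !psiE => Lxy.
  apply: val_inj; apply: (@intvec_inj R).
  have [u Pu uE] := tauP (asboolW (valP x)).
  have [v Pv vE] := tauP (asboolW (valP y)).
  have deg_eq : intvec R (val x) ord0 0 = intvec R (val y) ord0 0.
    by rewrite !mxE deg_yx.
  move: Lxy; rewrite uE vE deg_eq !LZ.
  have [->|t_neq0] := eqVneq (intvec R (val y) ord0 0) 0; first by rewrite !scale0r.
  move/(scalerI t_neq0); rewrite !L_phi ?(hH Pu) ?(hH Pv) // => phi_uv.
  by rewrite (phi_inj u v) //; apply/mem_set/aff_subset.
- move=> x y; apply: (@intvec_inj R).
  by rewrite intvecD !psiE /= intvecD LD.
move=> w; split=> [|[x <-]]; last first.
  apply/(nakajima_cone_intvec m R)/(nakajima_cone_tau _ _ adm_m); rewrite // psiE.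
  have [y Py ->] := tauP (asboolW (valP x)).
  exists (intvec R (val x) ord0 0), (phi y); split; last by rewrite LZ L_phi ?(hH Py).
    by apply: tau_deg_ge0; apply/asboolP/(valP x).
  exact: P2_phi.
move=> /(nakajima_cone_intvec m R).
case/(nakajima_cone_scale size_m free_m adm_m (leqnn _)) => [w_eq0|[]].
  exists (cone_one hP hH); apply: (@intvec_inj R).
  by rewrite psiE w_eq0 /= intvec0 /L mulmx0 mxE scale0r addr0.
set t := intvec R w ord0 0 => t_gt0; rewrite -/P2 -phi_P => - [p Pp pE].
have wE : intvec R w = t *: phi p by rewrite pE scalerA divff ?scale1r // gt_eqF.
(* Conversely, w - (t - 1) phi(z0) is a lattice point of the affine hull of the
   image; its preimage under phi is a lattice point of aff P. *)
have lineE : phi (t *: p + (1 - t) *: intvec R z0) = intvec R w + (1 - t) *: intvec R w0.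
  by rewrite -L_phi ?line_deg // LD !LZ !L_phi ?(hH Pp) ?(hH Pz0) // -wE w0E.
have [|q [q_aff [z _ zE]] qE] := phi_surj (phi (t *: p + (1 - t) *: intvec R z0)).
  split; first by apply: phi_aff; apply: aff_line.
  exists (w + (1 - w ord0 0) *: w0); rewrite ?lineE //.
  by apply/colP => i; rewrite /t !mxE intrD intrM intrB.
have {}qE : q = t *: p + (1 - t) *: intvec R z0.
  by apply: phi_inj => //; apply: mem_set => //; apply: aff_line.
have tpE : t *: p = intvec R (z + (w ord0 0 - 1) *: z0).
  have -> : intvec R (z + (w ord0 0 - 1) *: z0) = intvec R z + (t - 1) *: intvec R z0.
    by apply/colP => i; rewrite /t !mxE intrD intrM intrB.
  by rewrite zE qE -addrA -scalerDl addrA subrK subrr scale0r addr0.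
have tp_tau : in_tau P (z + (w ord0 0 - 1) *: z0).
  by apply/asboolP; exists t, p; split=> //; exact: ltW.
exists (exist (fun v => is_true (in_tau P v)) _ tp_tau); apply: (@intvec_inj R).
by rewrite psiE /= -tpE LZ L_phi ?(hH Pp) // wE.
Qed.

End LatticePoints.

(** * Koszulness of the monoid algebra *)

Section MonoidAlgebra.
Variables (K : fieldType) (M : conomType) (V : zmodType).
Variables (deg : {additive V -> int}) (N : set V) (psi : M -> V).
(* psi identifies the abstract monoid M with a submonoid N of a group, where
   subtraction expresses divisibility. *)
Hypothesis psi_inj : injective psi.
Hypothesis psiM : forall x y, psi (mmul x y) = psi x + psi y.
Hypothesis psiN : forall w, N w <-> exists x, psi x = w.
Hypothesis deg_ge0 : forall w, N w -> 0 <= deg w.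
Hypothesis deg_eq0 : forall w, N w -> deg w = 0 -> w = 0.

Local Notation A := {malg K[M]}.

Definition mdeg (x : M) : int := deg (psi x).

Definition graded_part (k : nat) : set A :=
  [set a | forall x, x \in msupp a -> mdeg x = k%:Z].

Definition component (k : nat) (a : A) : A :=
  [malg x in msupp a => if mdeg x == k%:Z then a@_x else 0].

Lemma N_psi x : N (psi x).
Proof. by apply/psiN; exists x. Qed.

Lemma psi1 : psi (mone : M) = 0.
Proof. by apply: (addrI (psi (mone : M))); rewrite -psiM mul1m addr0. Qed.

Lemma mdegM x y : mdeg (mmul x y) = mdeg x + mdeg y.
Proof. by rewrite /mdeg psiM raddfD. Qed.

Lemma mdeg_ge0 x : 0 <= mdeg x. Proof. exact/deg_ge0/N_psi. Qed.

Lemma mdeg_eq0 x : (mdeg x == 0) = (x == mone).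
Proof.
apply/eqP/eqP => [x0|->]; last by rewrite /mdeg psi1 raddf0.
by apply: psi_inj; rewrite psi1; apply: deg_eq0 => //; apply: N_psi.
Qed.

Lemma mulmI u : injective (fun x : M => mmul x u).
Proof. by move=> x y /(congr1 psi); rewrite !psiM => /addIr/psi_inj. Qed.

Lemma componentE k a x :
  (component k a)@_x = if mdeg x == k%:Z then a@_x else 0.
Proof. by rewrite mcoeffE; case: msuppP => // _; case: ifP. Qed.

Lemma componentD k : {morph component k : a b / a + b}.
Proof.
move=> a b; apply/malgP => x; rewrite mcoeffD !componentE mcoeffD.
by case: ifP; rewrite ?addr0.
Qed.

Lemma component_id k a : component k (component k a) = component k a.
Proof. by apply/malgP => x; rewrite !componentE; case: eqP. Qed.

Lemma graded_partE k a : graded_part k a <-> component k a = a.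
Proof.
split=> [ak|aE x].
  apply/malgP => x; rewrite componentE; case: msuppP => [/ak->|_]; last by case: ifP.
  by rewrite eqxx.
by rewrite -mcoeff_neq0 -aE componentE; case: (mdeg x =P k%:Z) => // _; rewrite eqxx.
Qed.

Lemma component_mul a g : component 1 g = g ->
  component 2 (a * g) = component 1 a * g.
Proof.
move=> g1; apply/malgP => z; rewrite componentE.
have sub : (msupp (component 1 a) `<=` msupp a)%fset.
  apply/fsubsetP => x; rewrite -!mcoeff_neq0 componentE.
  by case: ifP => // _; rewrite eqxx.
rewrite (mcoeffMlw z sub (fsubset_refl _)) mcoeffMl.
have termE x y : y \in msupp g ->
    ((component 1 a)@_x * g@_y) *+ (mmul x y == z) =
    if mdeg z == 2 then (a@_x * g@_y) *+ (mmul x y == z) else 0.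
  move=> /(proj2 (graded_partE 1 g) g1) y1; rewrite componentE.
  case: (mmul x y =P z) => [<-|_]; last by rewrite !mulr0n if_same.
  have -> : (mdeg (mmul x y) == 2) = (mdeg x == 1%:Z).
    by rewrite mdegM y1 -(inj_eq (addIr (1%:Z : int)) (mdeg x)).
  rewrite !mulr1n.
  by case: ifP; rewrite ?mul0r.
under [RHS]eq_bigr => x _ do under eq_big_seq => y yg do rewrite termE //.
case: (mdeg z == 2) => //.
by rewrite big1 // => x _; rewrite big1.
Qed.

Lemma graded_algebra_malg : graded_algebra graded_part.
Proof.
split.
- move=> k; split=> [x|c u v]; first by rewrite msupp0.
  rewrite !graded_partE => uk vk; apply/malgP => x.
  rewrite -uk -vk componentE !mcoeffD !mcoeffZ !componentE.
  by case: (mdeg x == k%:Z); rewrite ?mulr0 ?addr0.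
- move=> a; exists (\max_(x <- msupp a) absz (mdeg x)).+1, (component^~ a).
  split=> [k|]; first by apply/graded_partE; rewrite component_id.
  apply/malgP => x; rewrite raddf_sum /=.
  under eq_bigr do rewrite componentE.
  case: msuppP => [xa|_]; last by rewrite big1 // => k _; rewrite if_same.
  have xN : (absz (mdeg x) < (\max_(x <- msupp a) absz (mdeg x)).+1)%N.
    by rewrite ltnS; apply: leq_bigmax_seq.
  have xE := gez0_abs (mdeg_ge0 x).
  rewrite (bigD1 (Ordinal xN)) //= xE eqxx big1 ?addr0 // => k.
  rewrite -val_eqE /= => kx; case: (mdeg x =P k%:Z) kx => // ->.
  by rewrite absz_nat eqxx.
- move=> B c cP sum0 k kB; apply/malgP => x; rewrite mcoeff0.
  have /graded_partE ckE := cP k.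
  rewrite -ckE componentE; case: eqP => // xk.
  have /(congr1 (mcoeff x)) := sum0; rewrite mcoeff0 raddf_sum /=.
  rewrite (bigD1 (Ordinal kB)) //= big1 ?addr0 // => j.
  rewrite -val_eqE /= => jk; have /graded_partE <- := cP j.
  by rewrite componentE xk eqz_nat eq_sym (negPf jk).
- move=> i j u v ui vj x /msuppM_le[y [z [yu zv ->]]].
  by rewrite mdegM (ui _ yu) (vj _ zv) PoszD.
apply/seteqP; split=> [a a0|_ [c _ <-] x].
  exists a@_(mone : M) => //; apply/malgP => x; rewrite mcoeffZ mcoeff1.
  have [->|x1] := eqVneq x mone; first by rewrite mulr1.
  rewrite mulr0; case: msuppP => // /a0 x0.
  by rewrite -mdeg_eq0 x0 eqxx in x1.
rewrite -mcoeff_neq0 mcoeffZ mcoeff1 => cx; apply/eqP; rewrite mdeg_eq0.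
by apply: contraNT cx => /negPf->; rewrite mulr0.
Qed.

Definition divides_some (s : seq M) (z : M) : Prop :=
  exists2 u, u \in s & exists w, z = mmul w u.

(** The ideal generated by monomials is spanned by monomials, so membership can
    be tested on the support. *)
Lemma in_span_mono s (a : A^o) :
  in_span [seq << u >> : A^o | u <- s] a <->
  forall z, z \in msupp (a : A) -> divides_some s z.
Proof.
split.
  elim/last_ind: s a => [|s u IHs] a.
    by move=> /in_span_nil-> z; rewrite msupp0.
  rewrite map_rcons => /in_span_rcons[b /IHs{}IHs] z.
  have -> : a = (a - b *: (<< u >> : A^o)) + (b : A) * << u >> by rewrite subrK.
  move/(fsubsetP (msuppD_le _ _)); rewrite in_fsetU => /orP[/IHs[v vs [w ->]]|].
    by exists v; [rewrite mem_rcons inE vs orbT | exists w].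
  move/msuppM_le => [w [v [_ vu ->]]]; exists u; first by rewrite mem_rcons mem_head.
  by exists w; move: vu; rewrite msuppU1 in_fset1 => /eqP->.
move=> sa; rewrite (monalgE (a : A)) big_seq.
apply: big_ind => [||z /sa[u us [w ->]]]; [exact: in_span0 | exact: (@in_spanD _ A^o) |].
have -> : << a@_(mmul w u) *g mmul w u >> =
    << a@_(mmul w u) *g w >> *: (<< u >> : A^o).
  by rewrite -[RHS]/(_ * _) malgM_def fgmulUU mulr1.
by apply/in_spanZ/in_span_mem/map_f.
Qed.

Lemma msupp_mul_mono (a : A) u z :
  (mmul z u \in msupp (a * << u >>)) = (z \in msupp a).
Proof.
rewrite -!mcoeff_neq0 (mcoeffMrw _ (fsubset_refl _) (fsubset_refl _)) msuppU1.
rewrite big_seq_fset1 mcoeffUU.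
suff -> : \sum_(k1 <- msupp a) (a@_k1 * 1) *+ (mmul k1 u == mmul z u) = a@_z by [].
rewrite [X in _ = X@__]monalgE raddf_sum /=; apply: eq_bigr => x _.
by rewrite mcoeffU (inj_eq (@mulmI u)) mulr1.
Qed.

Lemma ideal_gen_psi s z : ideal_gen N (map psi s) (psi z) <-> divides_some s z.
Proof.
split=> [[_ /mapP[u us ->] /psiN[w wE]]|[u us [w ->]]].
  by exists u => //; exists w; apply: psi_inj; rewrite psiM wE subrK.
by exists (psi u); rewrite ?map_f // psiM addrK; apply/psiN; exists w.
Qed.

Variable F : set (set V).
Hypothesis F_face : face_filtration deg N F.

Definition monomial_lists (t : seq A^o) : Prop := exists2 s,
  stepwise (linear_step deg N F) (map psi s) & t = [seq << u >> : A^o | u <- s].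

Lemma koszul_list I : F I -> exists2 t, monomial_lists t
  & forall a : A, in_span t (a : A^o) <-> forall z, z \in msupp a -> I (psi z).
Proof.
move=> FI; have [s s_steps sE] := F_face.1 _ FI.
have [s' s'E] : exists s', s = map psi s'.
  have: forall u, u \in s -> N u.
    by move=> u us; move: s_steps; case/splitPr: us => s1 s2 /(_ _ _ _ erefl)[].
  elim: (s) => [|u s0 IHs] sN; first by exists [::].
  have [|s' ->] := IHs; first by move=> v vs; apply: sN; rewrite inE vs orbT.
  by have [|x <-] := (psiN u).1 (sN u _); [rewrite mem_head | exists (x :: s')].
exists [seq << u >> : A^o | u <- s']; first by exists s'; rewrite -?s'E.
move=> a; rewrite in_span_mono; split=> aI z za.
  by apply/(sE _ (N_psi z)); rewrite s'E; apply/ideal_gen_psi/aI.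
by apply/ideal_gen_psi; rewrite -s'E; apply/(sE _ (N_psi z))/aI.
Qed.

(** Multiplication by a monomial maps supports bijectively, so the colon ideal
    of a monomial ideal by a monomial is the monomial ideal of the
    combinatorial colon. *)
Lemma monomial_lists_filtered t : monomial_lists t ->
  @filtered A monomial_lists A^o (fun a : A => component 1 a = a) t.
Proof.
move=> [s s_steps ->] t1 x t2 t_eq.
have [s1 [u [s2 [sE <- <-]]]] := map_split t_eq.
have [_ degu [J FJ JE]] := s_steps (map psi s1) (psi u) (map psi s2)
  (etrans (congr1 (map psi) sE) (map_cat _ _ _)).
split.
  by apply/graded_partE => z; rewrite msuppU1 in_fset1 => /eqP->.
have [t' Ft' t'E] := koszul_list FJ; exists t' => // a.
rewrite in_span_mono t'E; split=> aJ z.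
  rewrite -(msupp_mul_mono _ u) => /aJ/ideal_gen_psi; rewrite psiM.
  by move/(JE _ (N_psi z)).
move/msuppM_le => [w [v [wa + ->]]]; rewrite msuppU1 in_fset1 => /eqP->.
by apply/ideal_gen_psi; rewrite psiM; apply/(JE _ (N_psi w))/aJ.
Qed.

Definition augmentation_ideal : A -> bool := fun a => a@_(mone : M) == 0.

Fact augmentation_ideal_closed : idealr_closed augmentation_ideal.
Proof.
split; rewrite ?inE /augmentation_ideal.
- by rewrite /in_mem /= mcoeff0.
- by rewrite /in_mem /= mcoeff1 eqxx oner_eq0.
move=> a u v; rewrite /in_mem /= => /eqP u0 /eqP v0.
by rewrite mcoeffD rmorphM /= u0 v0 mulr0 addr0.
Qed.

HB.instance Definition _ :=
  isIdealr.Build A augmentation_ideal augmentation_ideal_closed.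

(** An ideal containing the augmentation ideal and an element a also contains
    the constant term of a, which is a unit unless it vanishes. *)
Lemma augmentation_ideal_maximal :
  maximal_homogeneous_ideal graded_part augmentation_ideal.
Proof.
split=> [B c cP cI k kB|J _ IJ a aJ].
  apply/eqP; case: k kB => [|k] kB; last first.
    have /graded_partE <- := cP k.+1; rewrite componentE.
    by rewrite (eqP (_ : mdeg mone == 0)) // mdeg_eq0.
  move: cI; rewrite /in_mem /= => /eqP; rewrite raddf_sum /=.
  rewrite (bigD1 (Ordinal kB)) //= big1 ?addr0 // => j.
  rewrite -val_eqE /= => j0; have /graded_partE <- := cP j.
  by rewrite componentE (eqP (_ : mdeg mone == 0)) ?mdeg_eq0 // eqz_nat eq_sym (negPf j0).
apply: contraT; rewrite /in_mem /= /augmentation_ideal.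
set c := (a : A)@_(mone : M) => c_neq0.
have cJ : (c%:A : A) \in J.
  have -> : c%:A = a - (a - c%:A) :> A by rewrite subKr.
  apply: rpredB => //; apply: IJ; rewrite /in_mem /=.
  by rewrite /augmentation_ideal mcoeffB mcoeffZ mcoeff1 eqxx mulr1 subrr.
have := idealMr (c^-1%:A : A) cJ.
by rewrite -scalerAl mul1r scalerA mulVf // scale1r idealr1.
Qed.

Lemma koszul_monoid_algebra : koszul graded_part.
Proof.
split; first exact: graded_algebra_malg.
exists augmentation_ideal; split; first exact: augmentation_ideal_maximal.
have [I FI IE] := F_face.2 deg deg_ge0.
have [t Ft tE] := koszul_list FI.
have [b [D [b0 D_lin D0 D_exact]]] := linear_resolution (@componentD 1)
  (@componentD 2) (@component_id 1) component_mul monomial_lists_filtered Ft.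
exists b, (fun k _ => k%:Z), (fun=> 1), D; split=> /=.
- split=> [j|k i j]; last first.
    have -> : k.+1%:Z - k%:Z = 1 by rewrite -addn1 PoszD addrC addKr.
    exact/graded_partE/D_lin.
  exists 1; last by rewrite rmorph1.
  move=> x; rewrite -mcoeff_neq0 mcoeff1 => x1; apply/eqP; rewrite mdeg_eq0.
  by apply: contraNT x1 => /negPf->.
- by move=> k i j; apply/graded_partE/D_lin.
- move=> q; exists (const_mx (repr q)).
  under eq_bigr do rewrite mxE reprK mulr1.
  by rewrite sumr_const card_ord b0.
- move=> v; rewrite -D0.
  under eq_bigr do rewrite mulr1.
  rewrite -rmorph_sum /= tE; set a := \sum_j _.
  have pi0 : (\pi_{ideal_quot (augmentation_ideal : idealr A)} a == 0) =
      ((a : A)@_(mone : M) == 0).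
    rewrite -(rmorph0 \pi_{ideal_quot (augmentation_ideal : idealr A)}).
    by rewrite -(Quotient.idealrBE (augmentation_ideal : idealr A)) subr0.
  have IM z : I (psi z) <-> z != mone.
    by rewrite -mdeg_eq0 IE ?lt_def ?mdeg_ge0 ?andbT //; apply: N_psi.
  split=> [/eqP|aI].
    rewrite pi0 => a1 z za; apply/IM; apply: contraTneq za => ->.
    by rewrite -mcoeff_eq0.
  apply/eqP; rewrite pi0 mcoeff_eq0; apply/negP => /aI/IM.
  by rewrite eqxx.
exact: D_exact.
Qed.

End MonoidAlgebra.

Theorem proposition5p13 (R : realType) (n : nat) (P : set 'cV[R]_n.+1)
    (hP : lattice_polytope P) (hH : P `<=` Hbar R n) (hdim : aff_dim P n)
    (hN : is_nakajima P) :
  @koszul R[i] {malg R[i][cone_monoid hP hH]} (cone_grading hP hH).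
Proof.
have [m [psi [[size_m free_m adm_m] psi_inj psiM psi_deg psiN]]] :=
  nakajima_lattice_points hP hH hN.
have [F F_face] := nakajima_filtration size_m free_m adm_m (leqnn _).
have -> : cone_grading hP hH = graded_part (coord ord0) psi.
  apply/funext => k; apply/seteqP; split=> a ak x /ak.
    by rewrite /mdeg -psi_deg.
  by rewrite /mdeg -psi_deg.
apply: (@koszul_monoid_algebra _ _ _ (coord ord0) _ psi psi_inj psiM psiN _ _ F F_face).
  by move=> w wN; apply: (nakajima_cone_deg_ge0 wN).
by move=> w wN; apply: (nakajima_cone_deg0 wN) => // i; apply: free_next.
Qed.
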